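(* For every $d\in\mathbb{N}$ there exist $\beta_1,\beta_2,\beta_3,\beta_4>0$ such that, if $p_t:[0,1]\to P_{1,d}$ is a curve with $p_0,p_1\in P_{1,d}\setminus\Delta_{1,d}$ for which $t\mapsto\mu(p_t)$ is a constant-speed minimizing geodesic in $(\mathscr{P}(\mathbb{C}\mathrm{P}^1),W_2)$, then: (1) for every $t\in[0,1]$, $\mathrm{dist}(p_t,\Delta_{1,d})^2\ge\beta_1\min\{\mathrm{dist}(p_0,\Delta_{1,d}),\mathrm{dist}(p_1,\Delta_{1,d})\}^{\beta_2}$; in particular $p_t\notin\Delta_{1,d}$ for all $t$; (2) if $\gamma(t)=(p_t,z_t)$ is an absolutely continuous lift of $p_t$ to $V\setminus\Sigma'$, then $$L_{\mathrm{cond}}(\gamma)\le\beta_3\,L_V(\gamma)\,\max\{\nu_{\mathrm{norm}}(p_0,z_0),\nu_{\mathrm{norm}}(p_1,z_1)\}^{\beta_4}.$$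
   Context: $P_{1,d}$ is the projectivization of the space of complex binary forms of degree $d$; $\Delta_{1,d}\subset P_{1,d}$ those with a repeated projective root. For $p\in P_{1,d}$, $\mu(p)=\frac1d\sum_{z\in Z(p)}m_z(p)\delta_z\in\mathscr{P}(\mathbb{C}\mathrm{P}^1)$, $m_z(p)$ the multiplicity of the root $z$. $W_2$ is the quadratic Wasserstein distance with Fubini–Study cost on $\mathbb{C}\mathrm{P}^1$. The Bombieri–Weyl Hermitian product on binary forms makes $\sqrt{\binom{d}{k}}z_0^kz_1^{d-k}$ orthonormal; $\mathsf d_{\mathrm{BW}}$ is the induced Fubini–Study distance on $P_{1,d}$ and $\mathrm{dist}(p,\Delta_{1,d})=\mathsf d_{\mathrm{BW}}(p,\Delta_{1,d})$. $V=\{(p,z)\in P_{1,d}\times\mathbb{C}\mathrm{P}^1:p(z)=0\}$ with projection $\pi_1$ onto $P_{1,d}$, $\Sigma'$ the set of critical points of $\pi_1$; $g_V$ is the Riemannian metric on $V$ induced by the product of the Bombieri–Weyl Fubini–Study metric and the Fubini–Study metric of $\mathbb{C}\mathrm{P}^1$. For $z\in\mathbb{C}\mathrm{P}^1$, $\Delta_z$ is the set of $p$ with a multiple root at $z$, and $\nu_{\mathrm{norm}}(p,z)=\mathsf d_{\mathrm{BW}}(p,\Delta_z)^{-1}$. For an absolutely continuous curve $\gamma=(p_t,z_t)$ in $V\setminus\Sigma'$, $L_V(\gamma)=\int_0^1\|\dot\gamma_t\|_V\mathrm{d}t$ and $L_{\mathrm{cond}}(\gamma)=\int_0^1\nu_{\mathrm{norm}}(p_t,z_t)\|\dot\gamma_t\|_V\mathrm{d}t$.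 *)

(* Defs.v *)
From HB Require Import structures.
From mathcomp Require Import all_boot all_order all_algebra.
From mathcomp Require Import all_classical all_reals all_analysis.
From mathcomp Require Import complex.

Set Implicit Arguments.
Unset Strict Implicit.
Unset Printing Implicit Defensive.

Import Order.TTheory GRing.Theory Num.Theory.
Import numFieldNormedType.Exports.
Local Open Scope ring_scope.
Local Open Scope classical_set_scope.

Section Defs.
Variable R : realType.
Local Notation C := R[i].

Definition cabs (x : C) : R := Num.sqrt (complex.Re x ^+ 2 + complex.Im x ^+ 2).

(** Binary forms of degree d:  p = \sum_k p_k z0^k z1^(d-k),  coefficients
    indexed by k : 'I_d.+1.  Points of P_{1,d} are represented by nonzero forms
    (all notions below are invariant under nonzero scaling). *)
Definition bform (d : nat) := 'I_d.+1 -> C.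

(* the polynomial with coefficients p_k (binary form of degree d  <->
   polynomial of size <= d+1; product of forms = product of polynomials) *)
Definition bpoly d (p : bform d) : {poly C} := \poly_(k < d.+1) p (inord k).

(** CP^1 = C u {oo}:  Some a = [a:1],  None = [1:0]. *)
Definition cp1 := option C.
Definition cp1rep (z : cp1) : C * C :=
  match z with Some a => (a, 1) | None => (1, 0) end.

Definition beval d (p : bform d) (z : cp1) : C :=
  \sum_(k < d.+1) p k * (cp1rep z).1 ^+ k * (cp1rep z).2 ^+ (d - k).

(* the linear form b z0 - a z1 vanishing at [a:b], as a polynomial *)
Definition linf (z : cp1) : {poly C} :=
  (cp1rep z).2 *: 'X - ((cp1rep z).1)%:P.

(* (linear form of z)^m divides p as binary forms of degree d:
   p = L^m q with q a binary form of degree d - m *)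
Definition formdvd d (p : bform d) (z : cp1) (m : nat) : Prop :=
  exists q : {poly C}, (size q <= d - m + 1)%N /\ bpoly p = linf z ^+ m * q.

Definition mult d (p : bform d) (z : cp1) : nat :=
  \max_(m < d.+1 | `[< formdvd p z m >]) (m : nat).

Definition Delta d : set (bform d) :=
  [set p | p != (fun _ => 0) /\ exists z, (2 <= mult p z)%N].
Definition Delta_at d (z : cp1) : set (bform d) :=
  [set p | p != (fun _ => 0) /\ (2 <= mult p z)%N].

Definition herm2 (u v : C * C) : C := u.1 * conjc v.1 + u.2 * conjc v.2.
Definition nrm2 (u : C * C) : R := Num.sqrt (cabs u.1 ^+ 2 + cabs u.2 ^+ 2).
Definition fs_dist (z w : cp1) : R :=
  acos (cabs (herm2 (cp1rep z) (cp1rep w)) / (nrm2 (cp1rep z) * nrm2 (cp1rep w))).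

Definition bw d (p q : bform d) : C :=
  \sum_(k < d.+1) p k * conjc (q k) / ('C(d, k))%:R.
Definition bwnorm d (p : bform d) : R := Num.sqrt (complex.Re (bw p p)).
Definition dBW d (p q : bform d) : R :=
  acos (cabs (bw p q) / (bwnorm p * bwnorm q)).

Definition dist_set d (p : bform d) (S : set (bform d)) : R :=
  inf [set r | exists q, S q /\ r = dBW p q].

Definition distDelta d (p : bform d) : R := dist_set p (@Delta d).

Definition nu_norm d (p : bform d) (z : cp1) : R := (dist_set p (@Delta_at d z))^-1.

(** The root measure mu(p) = (1/d) sum_z m_z(p) delta_z, given by its
    (finitely supported) mass function on CP^1. *)
Definition mu d (p : bform d) : cp1 -> R := fun z => (mult p z)%:R / d%:R.

(** Quadratic Wasserstein distance between finitely supported probability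
    measures on CP^1 (given by mass functions).  A coupling of two finitely
    supported measures is finitely supported, hence is a finite list of
    weighted pairs of points. *)
Definition is_coupling (m1 m2 : cp1 -> R) (L : seq ((cp1 * cp1) * R)) : Prop :=
  [/\ forall x, x \in L -> 0 <= x.2,
      forall z, \sum_(x <- L | x.1.1 == z) x.2 = m1 z &
      forall w, \sum_(x <- L | x.1.2 == w) x.2 = m2 w].
Definition tcost (L : seq ((cp1 * cp1) * R)) : R :=
  \sum_(x <- L) x.2 * fs_dist x.1.1 x.1.2 ^+ 2.
Definition W2 (m1 m2 : cp1 -> R) : R :=
  Num.sqrt (inf [set c | exists L, is_coupling m1 m2 L /\ c = tcost L]).

(** Riemannian structure on V (metric induced by the product metric):
    speed of a curve = metric derivative for the product distance
    sqrt(d_BW^2 + d_FS^2), which coincides a.e. with ||gamma'||_V. *)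
Definition dprod d (x y : bform d * cp1) : R :=
  Num.sqrt (dBW x.1 y.1 ^+ 2 + fs_dist x.2 y.2 ^+ 2).

Definition speedV d (g : R -> bform d * cp1) (t : R) : R :=
  lim ((fun h : R => dprod (g (t + h)) (g t) / `|h|) @ 0^').

Definition abs_cont d (g : R -> bform d * cp1) : Prop :=
  exists m : R -> R,
    (lebesgue_measure).-integrable `[0, 1] (fun t => (m t)%:E) /\
    forall s t, 0 <= s -> s <= t -> t <= 1 ->
      ((dprod (g s) (g t))%:E <= \int[lebesgue_measure]_(x in `[s, t]) (m x)%:E)%E.

(* Sigma': critical points of pi_1 restricted to V, i.e. pairs (p,z) in V
   where z is a multiple root of p *)
Definition inV d (p : bform d) (z : cp1) : Prop := beval p z = 0.
Definition inSigma' d (p : bform d) (z : cp1) : Prop := inV p z /\ (2 <= mult p z)%N.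

Definition L_V d (g : R -> bform d * cp1) : \bar R :=
  \int[lebesgue_measure]_(t in `[0, 1]) (speedV g t)%:E.
Definition L_cond d (g : R -> bform d * cp1) : \bar R :=
  \int[lebesgue_measure]_(t in `[0, 1]) (nu_norm (g t).1 (g t).2 * speedV g t)%:E.

End Defs.

(* Main.v *)
(** A constant-speed geodesic between finitely supported measures splits, at every
    interior time [t], into weighted triples [(x0, xt, x1)] in which [xt] divides
    the distance from [x0] to [x1] in the ratio [t : 1 - t], and the pairs
    [(x0, x1)] of the triples are monotone for the squared distance.  The
    Fubini-Study metric on [CP^1] has nonnegative curvature, which turns
    monotonicity into
      [d(xt, yt)^2 >= (1 - t)^2 d(x0, y0)^2 + t^2 d(x1, y1)^2].
    Hence the triples never meet at time [t]; as the roots at the ends are simple,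
    so are those of [p_t], and they stay separated by half the smallest gap at the
    ends.  Gaps between roots and distances to [Delta] control each other
    polynomially: moving one root onto another costs at most a multiple of their
    distance, while the values and derivatives of [p] at [z] bound from below its
    distance to the forms with a double root at [z].  A continuous lift [z_t]
    follows a single triple, which gives the pointwise bound on [nu_norm] needed
    for the condition length. *)
Require Import Defs.
From HB Require Import structures.
From mathcomp Require Import all_boot all_order all_algebra.
From mathcomp Require Import all_classical all_reals all_analysis.
From mathcomp Require Import complex ring lra zify.
Set Implicit Arguments.
Unset Strict Implicit.
Unset Printing Implicit Defensive.
Import Order.TTheory GRing.Theory Num.Theory.
Import numFieldNormedType.Exports.
Local Open Scope ring_scope.
Local Open Scope classical_set_scope.

(** * Geometry of the Fubini-Study metric on CP^1 *)

(** Nothing labels the roots along the curve, and optimal plans are not known to be unique, so no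
    family of root paths over the whole of [[0, 1]] is built. At each interior [t] one plan from 0
    to [t] and one from [t] to 1 are glued over the middle measure; the equality [W2 = |t - s| W]
    forces the glued plan to be optimal, and the triples are read off from it. That the roots at
    time [t] are simple is a count of masses: a root of multiplicity [k] weighs [k / d]. The
    obstacle in (2) is that a triple through [z t] must be shown to end at [z 0] and at [z 1]. This
    is done with chained short plans: a uniform speed bound for the triples and the uniform
    continuity of the lift leave a single root within reach at each step. The lower bound for the
    distance to a form with a double root is a squared product of [d - 1] sines. Gaps therefore
    enter to the power [n = 2 (d - 1)], which is the exponent in (2); in (1) it is [2 n], because
    the distance is squared there. *)

(** Concavity of the sine: its mean slope on [[0, a]] is at least that on [[a, b]], because the
    cosine decreases. Without quotients, [a = 0] is no special case. *)
Lemma sin_chord (R : realType) (a b : R) : 0 <= a -> a <= b -> b <= pi ->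
  a * sin b <= b * sin a.
Proof.
move=> a0 ab bpi.
have cs (x y : R) := @continuous_subspaceT _ _ (`[x, y]) _ (@continuous_sin R).
have [c1] := @MVT_segment R sin cos 0 a a0 (fun x _ => is_derive_sin x) (cs 0 a).
have [c2] := @MVT_segment R sin cos a b ab (fun x _ => is_derive_sin x) (cs a b).
rewrite !in_itv/= sin0 !subr0 => /andP[ac2 c2b] e2 /andP[c10 c1a] e1.
have : cos c2 <= cos c1.
  rewrite leNgt ltr_cos ?in_itv/= -?leNgt; lra.
move=> h.
have -> : sin b = cos c2 * (b - a) + cos c1 * a by lra.
have : 0 <= a * (b - a) * (cos c1 - cos c2) by rewrite !mulr_ge0 ?subr_ge0.
rewrite e1; lra.
Qed.

(** Multiplied by [sin c], this is the tangent line inequality at [cos c] for the convex function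
    [acos ^+ 2], whose slope there is [- 2 c / sin c]. By [sin_chord] the derivative of [f] changes
    sign at [c], where [f] is thus minimal. *)
Lemma cos_support (R : realType) (a c : R) : 0 <= a <= pi -> 0 <= c <= pi ->
  c ^+ 2 * sin c + 2 * c * cos c <= a ^+ 2 * sin c + 2 * c * cos a.
Proof.
move=> /andP[a0 api] /andP[c0 cpi].
pose f := fun x : R => x ^+ 2 * sin c + 2 * c * cos x.
pose df := fun x : R => 2 * (x * sin c - c * sin x).
have fd (x : R) : is_derive x 1 f (df x).
  rewrite /f /df; apply: is_derive_eq.
  rewrite /GRing.scale /=; ring.
have cf : continuous f.
  move=> x; apply: differentiable_continuous; apply/derivable1_diffP.
  by have [] := fd x.
rewrite -/(f c) -/(f a).
have [ac|/ltW ca] := leP a c.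
  have [x] := @MVT_segment R f df a c ac (fun x _ => fd x) (continuous_subspaceT cf).
  rewrite in_itv/= => /andP[ax xc] e.
  have := @sin_chord R x c (le_trans a0 ax) xc cpi.
  rewrite /df in e; nra.
have [x] := @MVT_segment R f df c a ca (fun x _ => fd x) (continuous_subspaceT cf).
rewrite in_itv/= => /andP[ax xc] e.
have := @sin_chord R c x c0 ax (le_trans xc api).
rewrite /df in e; nra.
Qed.

Lemma cos_eqN1 (R : realType) (x : R) : -pi <= x -> x < 3 * pi -> cos x = -1 -> x = pi \/ x = -pi.
Proof.
move=> h1 h2 h3; have p0 := @pi_gt0 R.
have [xpi|xpi] := leP x pi.
  have [x0|x0] := leP 0 x.
    by left; apply: cos_inj; rewrite ?in_itv/= ?cospi//; apply/andP; split; lra.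
  right; apply/eqP; rewrite -eqr_oppLR; apply/eqP.
  by apply: cos_inj; rewrite ?in_itv/= ?cosN ?cospi//; apply/andP; split; lra.
have h4 : cos (x - 2 * pi) = -1.
  by rewrite mulr_natl cosB cos2pi sin2pi h3; ring.
have [x0|x0] := leP 0 (x - 2*pi).
  have : x - 2 * pi = pi by apply: cos_inj; rewrite ?in_itv/= ?cospi//; apply/andP; split; lra.
  lra.
have : -(x - 2 * pi) = pi.
  by apply: cos_inj; rewrite ?in_itv/= ?cosN ?cospi//; apply/andP; split; lra.
lra.
Qed.

(* [acos ^+ 2] is convex, and the inequality is an equality (or obvious) at
   [k = 1] and [k = -1]. *)
Lemma spherical_hinge (R : realType) (a b c k : R) :
  0 <= a <= pi -> 0 <= b <= pi -> 0 <= c <= pi -> -1 <= k <= 1 ->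
  cos c = cos a * cos b + k * (sin a * sin b) ->
  c ^+ 2 <= a ^+ 2 + b ^+ 2 - 2 * a * b * k.
Proof.
move=> /andP[a0 api] /andP[b0 bpi] /andP[c0 cpi] /andP[kN1 k1] e.
have p0 := @pi_gt0 R.
(* [cos c] is a convex combination of two cosines, so the tangent line at [cos c] is applied at
   [a - b] and at [a + b] and averaged with the same weights. *)
have e3 : cos c = (1 + k) / 2 * cos (a - b) + (1 - k) / 2 * cos (a + b).
  by rewrite e cosB cosD; lra.
(* The tangent at [c = pi] is vertical. Here [cos c = -1] forces every cosine of positive weight to
   be [-1], which leaves finitely many configurations. *)
have [/eqP c_pi|cNpi] := boolP (c == pi).
  move: e3; rewrite c_pi cospi => e3.
  have g1 := cos_geN1 (a - b); have g2 := cos_geN1 (a + b).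
  have h1 : (1 + k) * (cos (a - b) + 1) = 0 by nra.
  have h2 : (1 - k) * (cos (a + b) + 1) = 0 by nra.
  have h3 : k = -1 \/ a - b = pi \/ a - b = -pi.
    move/eqP: h1; rewrite mulf_eq0 => /orP[/eqP h|/eqP h]; first by left; lra.
    by right; apply: cos_eqN1; lra.
  have h4 : k = 1 \/ a + b = pi.
    move/eqP: h2; rewrite mulf_eq0 => /orP[/eqP h|/eqP h]; first by left; lra.
    by right; case: (@cos_eqN1 R (a + b)); lra.
  case: h4 => [k_1|h4].
    have : (a - b) ^+ 2 = pi ^+ 2 by case: h3 => [|[->|->]]; [lra|by []|exact: sqrrN].
    by rewrite k_1; lra.
  case: h3 => [->|h3].
    by have : (a + b) ^+ 2 = pi ^+ 2; [rewrite h4|lra].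
  have h5 := congr1 (fun x => x ^+ 2) h4; rewrite /= in h5.
  case: h3 => h3; last first.
    have a_0 : a = 0 by lra.
    by rewrite a_0 in h5 *; lra.
  have b_0 : b = 0 by lra.
  by rewrite b_0 in h5 *; lra.
have [/eqP c_0|cN0] := boolP (c == 0).
  have : 0 <= a * b * (1 - k) by rewrite !mulr_ge0 ?subr_ge0.
  by have := sqr_ge0 (a - b); rewrite c_0; nra.
have c_gt0 : 0 < c by rewrite lt_neqAle eq_sym cN0.
have sc : 0 < sin c by apply: sin_gt0_pi; rewrite c_gt0 lt_neqAle cNpi.
have s1 : c ^+ 2 * sin c + 2 * c * cos c <= (a - b) ^+ 2 * sin c + 2 * c * cos (a - b).
  have := @cos_support R `|a - b| c; rewrite cos_norm real_normK ?num_real//; apply.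
    by rewrite normr_ge0 ler_norml; apply/andP; split; lra.
  by rewrite c0.
have s2 : c ^+ 2 * sin c + 2 * c * cos c <= (a + b) ^+ 2 * sin c + 2 * c * cos (a + b).
  (* Beyond [pi], the angle [a + b] is replaced by [2 pi - (a + b)], which has the same cosine and a
     smaller square. *)
  have [h|h] := leP (a + b) pi.
    apply: cos_support; [by rewrite h addr_ge0|by rewrite c0].
  have := @cos_support R (2 * pi - (a + b)) c.
  rewrite (_ : cos (2 * pi - (a + b)) = cos (a + b)); last first.
    by rewrite mulr_natl cosB cos2pi sin2pi; ring.
  move=> /(_ _ _)/le_trans; apply; first by apply/andP; split; lra.
    by rewrite c0.
  rewrite lerD2r ler_pM2r//; nra.
have {}s1 : (1 + k) / 2 * (c ^+ 2 * sin c + 2 * c * cos c) <=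
   (1 + k) / 2 * ((a - b) ^+ 2 * sin c + 2 * c * cos (a - b)).
  by apply: ler_wpM2l => //; lra.
have {}s2 : (1 - k) / 2 * (c ^+ 2 * sin c + 2 * c * cos c) <=
   (1 - k) / 2 * ((a + b) ^+ 2 * sin c + 2 * c * cos (a + b)).
  by apply: ler_wpM2l => //; lra.
rewrite -(ler_pM2r sc).
have : c * cos c = c * ((1 + k) / 2 * cos (a - b) + (1 - k) / 2 * cos (a + b)) by rewrite e3.
lra.
Qed.

(** * The projective line as a round sphere *)

Section CP1.
Variable R : realType.
Local Notation C := R[i].
Implicit Types (z w x y p : cp1 R) (u v : C * C).

Lemma cabs_sqr (a : C) : cabs a ^+ 2 = complex.Re a ^+ 2 + complex.Im a ^+ 2.
Proof. by rewrite sqr_sqrtr// addr_ge0 ?sqr_ge0. Qed.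

Lemma cabs_ge0 (a : C) : 0 <= cabs a.
Proof. exact: sqrtr_ge0. Qed.

Definition det2 u v : C := u.1 * v.2 - u.2 * v.1.

Lemma nrm2_sqr u : nrm2 u ^+ 2 = cabs u.1 ^+ 2 + cabs u.2 ^+ 2.
Proof. by rewrite sqr_sqrtr// addr_ge0 ?sqr_ge0. Qed.

Lemma nrm2_rep_gt0 z : 0 < nrm2 (cp1rep z).
Proof.
rewrite sqrtr_gt0; case: z => [[a b]|] /=; rewrite !cabs_sqr/=; nra.
Qed.

(** Lagrange's identity. It contains the Cauchy-Schwarz inequality and turns the determinant of two
    representatives into the sine of their distance. *)
Lemma lagrange2 u v :
  cabs (herm2 u v) ^+ 2 + cabs (det2 u v) ^+ 2 = nrm2 u ^+ 2 * nrm2 v ^+ 2.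
Proof.
rewrite !nrm2_sqr !cabs_sqr /herm2 /det2.
case: u => [[a b] [c e]]; case: v => [[f g] [h k]] /=; ring.
Qed.

Lemma fs_arg z w :
  0 <= cabs (herm2 (cp1rep z) (cp1rep w)) / (nrm2 (cp1rep z) * nrm2 (cp1rep w)) <= 1.
Proof.
have z0 := nrm2_rep_gt0 z; have w0 := nrm2_rep_gt0 w.
have zw0 : 0 < nrm2 (cp1rep z) * nrm2 (cp1rep w) by rewrite mulr_gt0.
rewrite divr_ge0 ?cabs_ge0 ?(ltW zw0)//= ler_pdivrMr// mul1r.
rewrite -(@ler_pXn2r _ 2)// ?nnegrE ?cabs_ge0 ?(ltW zw0)//.
by rewrite exprMn -lagrange2 lerDl sqr_ge0.
Qed.

Lemma fs_cos z w : cos (fs_dist z w) =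
  cabs (herm2 (cp1rep z) (cp1rep w)) / (nrm2 (cp1rep z) * nrm2 (cp1rep w)).
Proof.
by rewrite acosK// in_itv/=; have /andP[] := fs_arg z w => h ->; rewrite andbT; lra.
Qed.

Lemma fs_ge0 z w : 0 <= fs_dist z w.
Proof. by apply: acos_ge0; have := fs_arg z w; lra. Qed.

Lemma fs_le z w : fs_dist z w <= pi / 2.
Proof.
have p0 := @pi_gt0 R.
have fpi : fs_dist z w <= pi by apply: acos_lepi; have := fs_arg z w; lra.
rewrite leNgt -ltr_cos ?in_itv/= ?fs_ge0//; last by apply/andP; split; lra.
by rewrite cos_pihalf fs_cos -leNgt; have /andP[] := fs_arg z w.
Qed.

Lemma fs_sin_ge0 z w : 0 <= sin (fs_dist z w).
Proof.
by apply: sin_ge0_pi; have := @pi_gt0 R; have := fs_ge0 z w; have := fs_le z w; lra.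
Qed.

Lemma fs_sin z w : sin (fs_dist z w) =
  cabs (det2 (cp1rep z) (cp1rep w)) / (nrm2 (cp1rep z) * nrm2 (cp1rep w)).
Proof.
have z0 := nrm2_rep_gt0 z; have w0 := nrm2_rep_gt0 w.
have zw0 : 0 < nrm2 (cp1rep z) * nrm2 (cp1rep w) by rewrite mulr_gt0.
apply/eqP; rewrite -(@eqrXn2 _ 2)// ?fs_sin_ge0 ?divr_ge0 ?cabs_ge0 ?(ltW zw0)//.
apply/eqP; rewrite sin2cos2 fs_cos !expr_div_n.
have <- : (nrm2 (cp1rep z) * nrm2 (cp1rep w)) ^+ 2 / (nrm2 (cp1rep z) * nrm2 (cp1rep w)) ^+ 2 = 1.
  by rewrite divff// expf_neq0// gt_eqF.
by rewrite -mulrBl exprMn -lagrange2 addrC addKr.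
Qed.

(** Inverse stereographic projection onto the unit sphere. The Fubini-Study distance is half of the
    spherical angle, whence the factor 2 in front of [fs_dist] in the lemmas of spherical
    trigonometry. *)
Definition bloch z : R * R * R :=
  match z with
  | Some a => let n := complex.Re a ^+ 2 + complex.Im a ^+ 2 in
    (2 * complex.Re a / (n + 1), 2 * complex.Im a / (n + 1), (n - 1) / (n + 1))
  | None => (0, 0, 1)
  end.

Definition dot3 (x y : R * R * R) := x.1.1 * y.1.1 + x.1.2 * y.1.2 + x.2 * y.2.

Lemma fs_bloch z w : cos (2 * fs_dist z w) = dot3 (bloch z) (bloch w).
Proof.
rewrite mulr_natl cos_mulr2n fs_cos expr_div_n exprMn !nrm2_sqr !cabs_sqr /dot3.
case: z => [[a b]|]; case: w => [[c e]|] /=; rewrite !(mulr0, mul0r, mulr1, mul1r, addr0, add0r, subr0, expr0n, expr1n, oppr0)/=.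
- field; apply/andP; split; apply: lt0r_neq0; nra.
- field; apply: lt0r_neq0; nra.
- field; apply: lt0r_neq0; nra.
- lra.
Qed.

Lemma bloch_unit z : dot3 (bloch z) (bloch z) = 1.
Proof.
rewrite /dot3; case: z => [[a b]|] /=; last by lra.
field; apply: lt0r_neq0; nra.
Qed.

Lemma fs_sym z w : fs_dist z w = fs_dist w z.
Proof.
have p0 := @pi_gt0 R.
have h z' w' : 2 * fs_dist z' w' \in `[0, pi]%R.
  by rewrite in_itv/=; have := fs_ge0 z' w'; have := fs_le z' w'; lra.
suff : 2 * fs_dist z w = 2 * fs_dist w z by lra.
apply: cos_inj; rewrite ?h// !fs_bloch /dot3; ring.
Qed.

Lemma fs_refl z : fs_dist z z = 0.
Proof.
have p0 := @pi_gt0 R.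
suff : 2 * fs_dist z z = 0 by lra.
apply: cos_inj; rewrite ?in_itv/= ?fs_bloch ?cos0 ?bloch_unit//; first last.
  by apply/andP; split; lra.
by have := fs_ge0 z z; have := fs_le z z; lra.
Qed.

Lemma cabs_eq0 (a : C) : cabs a = 0 -> a = 0.
Proof.
move=> h; have := cabs_sqr a; rewrite h expr0n/=; case: a h => a b /= _ e.
by have [-> ->] : a = 0 /\ b = 0 by split; apply/eqP; rewrite -sqrf_eq0; apply/eqP; nra.
Qed.

Lemma fs_eq0 z w : fs_dist z w = 0 -> z = w.
Proof.
move=> h; have := fs_sin z w; rewrite h sin0 => /esym/eqP.
have nz : nrm2 (cp1rep z) * nrm2 (cp1rep w) != 0 by rewrite mulf_neq0// gt_eqF// nrm2_rep_gt0.
rewrite mulf_eq0 invr_eq0 (negbTE nz) orbF => /eqP/cabs_eq0.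
rewrite /det2; case: z {h nz} => [a|]; case: w => [b|] //=; rewrite ?mulr1 ?mul1r ?mulr0 ?mul0r ?subr0 ?sub0r.
- by move/eqP; rewrite subr_eq0 => /eqP ->.
- by move/eqP; rewrite oppr_eq0 oner_eq0.
- by move/eqP; rewrite oner_eq0.
Qed.

(** The difference of the two sides is the Gram determinant of the three vectors, which is the
    square of their triple product. *)
Lemma gram3 (x y p : R * R * R) : dot3 x x = 1 -> dot3 y y = 1 -> dot3 p p = 1 ->
  (dot3 p x - dot3 p y * dot3 x y) ^+ 2 <= (1 - dot3 p y ^+ 2) * (1 - dot3 x y ^+ 2).
Proof.
move=> hx hy hp; rewrite -subr_ge0.
suff -> : (1 - dot3 p y ^+ 2) * (1 - dot3 x y ^+ 2) - (dot3 p x - dot3 p y * dot3 x y) ^+ 2 =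
   (x.1.1 * (y.1.2 * p.2 - y.2 * p.1.2) - x.1.2 * (y.1.1 * p.2 - y.2 * p.1.1)
     + x.2 * (y.1.1 * p.1.2 - y.1.2 * p.1.1)) ^+ 2 by exact: sqr_ge0.
transitivity (dot3 x x * dot3 y y * dot3 p p + 2 * (dot3 p x * dot3 p y * dot3 x y)
  - dot3 p y ^+ 2 * dot3 x x - dot3 x y ^+ 2 * dot3 p p - dot3 p x ^+ 2 * dot3 y y).
  rewrite hx hy hp; ring.
rewrite /dot3; ring.
Qed.

(* [k] plays the role of the cosine of the angle at [y]. *)
Lemma fs_hinge_cos x y p : let k := (dot3 (bloch p) (bloch x) -
    dot3 (bloch p) (bloch y) * dot3 (bloch x) (bloch y)) /
    (sin (2 * fs_dist x y) * sin (2 * fs_dist p y)) in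
  -1 <= k <= 1 /\ cos (2 * fs_dist p x) =
  cos (2 * fs_dist x y) * cos (2 * fs_dist p y) +
  k * (sin (2 * fs_dist x y) * sin (2 * fs_dist p y)).
Proof.
have p0 := @pi_gt0 R.
have sg z w : 0 <= sin (2 * fs_dist z w).
  by apply: sin_ge0_pi; have := fs_ge0 z w; have := fs_le z w; lra.
have := @gram3 (bloch x) (bloch y) (bloch p) (bloch_unit x) (bloch_unit y) (bloch_unit p).
rewrite -!fs_bloch -!sin2cos2.
set s := sin (2 * fs_dist x y); set s' := sin (2 * fs_dist p y).
rewrite -exprMn => h /=.
(* If a sine vanishes then [k = 0], by the convention for division by zero; [gram3] then gives the
   law of cosines without its last term. *)
have [ss0|ss0] := boolP (s * s' == 0).
  move: h; rewrite mulrC in ss0; rewrite (eqP ss0) expr0n/= => h.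
  have {}h : cos (2 * fs_dist p x) - cos (2 * fs_dist p y) * cos (2 * fs_dist x y) = 0.
    by apply/eqP; rewrite -sqrf_eq0 eq_le h sqr_ge0.
  rewrite h mul0r; split; [by apply/andP; split; lra|].
  by rewrite mul0r; lra.
have ss : 0 < s * s' by rewrite lt_neqAle eq_sym ss0 mulr_ge0// sg.
split; last by rewrite divfK//; ring.
rewrite -ler_norml normrM normfV (gtr0_norm ss) ler_pdivrMr// mul1r.
rewrite -(@ler_pXn2r _ 2)// ?nnegrE ?(ltW ss)// real_normK ?num_real//.
by rewrite mulrC in h *; rewrite [s * s']mulrC.
Qed.

(** The hinge inequality for the worst angle, [k = -1]. *)
Lemma fs_triangle x y z : fs_dist x z <= fs_dist x y + fs_dist y z.
Proof.
have p0 := @pi_gt0 R.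
have bd z' w' : 0 <= 2 * fs_dist z' w' <= pi.
  by have := fs_ge0 z' w'; have := fs_le z' w'; lra.
have [] := fs_hinge_cos x y z; set k := (X in -1 <= X <= 1) => kb e.
have := @spherical_hinge R _ _ _ _ (bd x y) (bd z y) (bd z x) kb e.
rewrite (fs_sym z x) (fs_sym z y) => h.
rewrite -(@ler_pXn2r _ 2)// ?nnegrE ?addr_ge0 ?fs_ge0//.
have := fs_ge0 x y; have := fs_ge0 y z => h1 h2.
have : 0 <= fs_dist x y * fs_dist y z * (1 + k) by rewrite !mulr_ge0//; lra.
nra.
Qed.

(** Equality in the triangle inequality puts the three points on a great circle. The vector
    [(w1, w2, w3)] expresses this: its squared norm depends only on the cosines of [A], [B] and
    [A + B], and comes out as zero; pairing it with [bloch p] gives the claim. *)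
Lemma between_bloch x0 xt x1 : let A := 2 * fs_dist x0 xt in let B := 2 * fs_dist xt x1 in
  2 * fs_dist x0 x1 = A + B -> forall p,
  sin B * dot3 (bloch p) (bloch x0) + sin A * dot3 (bloch p) (bloch x1)
   = sin (A + B) * dot3 (bloch p) (bloch xt).
Proof.
move=> A B e p.
have := fs_bloch x0 x1; rewrite e.
have := fs_bloch x0 xt; rewrite -/A; have := fs_bloch xt x1; rewrite -/B.
have := bloch_unit x0; have := bloch_unit x1; have := bloch_unit xt.
rewrite /dot3; case: (bloch x0) => [[a1 a2] a3]; case: (bloch x1) => [[b1 b2] b3].
case: (bloch xt) => [[c1 c2] c3]; case: (bloch p) => [[p1 p2] p3] /=.
rewrite cosD sinD => hc hb ha hB hA hAB.
have sA := cos2Dsin2 A; have sB := cos2Dsin2 B.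
set sa := sin A in sA hAB *; set sb := sin B in sB hAB *.
set ca := cos A in sA hA hAB *; set cb := cos B in sB hB hAB *.
set S := sa * cb + ca * sb.
pose w1 := sb * a1 + sa * b1 - S * c1; pose w2 := sb * a2 + sa * b2 - S * c2.
pose w3 := sb * a3 + sa * b3 - S * c3.
have : w1 ^+ 2 + w2 ^+ 2 + w3 ^+ 2 = 0.
  transitivity (sb ^+ 2 * (a1 * a1 + a2 * a2 + a3 * a3) + sa ^+ 2 * (b1 * b1 + b2 * b2 + b3 * b3)
    + S ^+ 2 * (c1 * c1 + c2 * c2 + c3 * c3) + 2 * sa * sb * (a1 * b1 + a2 * b2 + a3 * b3)
    - 2 * S * sb * (a1 * c1 + a2 * c2 + a3 * c3) - 2 * S * sa * (c1 * b1 + c2 * b2 + c3 * b3)).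
    rewrite /w1 /w2 /w3; ring.
  rewrite ha hb hc -hA -hB -hAB /S.
  transitivity (sa ^+ 2 * (1 - (cb ^+ 2 + sb ^+ 2)) + sb ^+ 2 * (1 - (ca ^+ 2 + sa ^+ 2))).
    ring.
  by rewrite sA sB; ring.
move=> hw.
have z1 : w1 = 0 by apply/eqP; rewrite -sqrf_eq0; apply/eqP; nra.
have z2 : w2 = 0 by apply/eqP; rewrite -sqrf_eq0; apply/eqP; nra.
have z3 : w3 = 0 by apply/eqP; rewrite -sqrf_eq0; apply/eqP; nra.
apply/eqP; rewrite -subr_eq0; apply/eqP.
transitivity (p1 * w1 + p2 * w2 + p3 * w3); first by rewrite /w1 /w2 /w3; ring.
by rewrite z1 z2 z3; ring.
Qed.
End CP1.

(** The angles at [xt] towards [x0] and [x1] are supplementary, so [k1 = - k0]. The two legs are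
    proportional to [t] and [1 - t]; hence the angle terms cancel when the two hinge inequalities
    are added with weights [1 - t] and [t]. *)
Lemma fs_nonneg_curvature (R : realType) (x0 xt x1 p : cp1 R) (t : R) : 0 < t < 1 ->
  fs_dist x0 xt = t * fs_dist x0 x1 -> fs_dist xt x1 = (1 - t) * fs_dist x0 x1 ->
  (1 - t) * fs_dist p x0 ^+ 2 + t * fs_dist p x1 ^+ 2 -
     t * (1 - t) * fs_dist x0 x1 ^+ 2 <= fs_dist p xt ^+ 2.
Proof.
move=> /andP[t0 t1] e0 e1.
have p0 := @pi_gt0 R.
have bd (z' w' : cp1 R) : 0 <= 2 * fs_dist z' w' <= pi.
  by have := fs_ge0 z' w'; have := fs_le z' w'; lra.
have [/eqP l0|l0] := boolP (fs_dist x0 x1 == 0).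
  have <- : x0 = x1 by exact: fs_eq0.
  have <- : x0 = xt by apply: fs_eq0; rewrite e0 l0 mulr0.
  by rewrite fs_refl; lra.
have lp : 0 < fs_dist x0 x1 by rewrite lt_neqAle eq_sym l0 fs_ge0.
have lpi := fs_le x0 x1.
have sA : 0 < sin (2 * fs_dist x0 xt).
  by apply: sin_gt0_pi; rewrite e0; apply/andP; split; nra.
have sB : 0 < sin (2 * fs_dist xt x1).
  by apply: sin_gt0_pi; rewrite e1; apply/andP; split; nra.
have [] := fs_hinge_cos x0 xt p; set k0 := (X in -1 <= X <= 1) => kb0 h0.
have [] := fs_hinge_cos x1 xt p; set k1 := (X in -1 <= X <= 1) => kb1 h1.
have bt := @between_bloch _ x0 xt x1 _ p.
have k01 : k1 = - k0.
  have {}bt := bt ltac:(rewrite e0 e1; ring).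
  have e : dot3 (bloch p) (bloch x1) - dot3 (bloch p) (bloch xt) * dot3 (bloch x1) (bloch xt)
    = - (sin (2 * fs_dist xt x1) / sin (2 * fs_dist x0 xt) * (dot3 (bloch p) (bloch x0) -
       dot3 (bloch p) (bloch xt) * dot3 (bloch x0) (bloch xt))).
    rewrite -(fs_bloch x1 xt) -(fs_bloch x0 xt) (fs_sym x1 xt).
    apply: (mulfI (lt0r_neq0 sA)).
    rewrite mulrBr mulrN !mulrA [_ * sin (2 * fs_dist xt x1)]mulrC mulfK ?(lt0r_neq0 sA)//.
    move: bt; rewrite sinD; lra.
  rewrite /k1 /k0 e (fs_sym x1 xt) mulNr; congr (- _).
  set N := dot3 _ _ - _; rewrite !invfM.
  move: (lt0r_neq0 sB); set sb := sin (2 * fs_dist xt x1) => sb0.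
  by rewrite -[RHS](mulfK sb0); ring.
have g0 := @spherical_hinge R _ _ _ _ (bd x0 xt) (bd p xt) (bd p x0) kb0 h0.
have g1 := @spherical_hinge R _ _ _ _ (bd x1 xt) (bd p xt) (bd p x1) kb1 h1.
move: g0 g1; rewrite k01 (fs_sym x1 xt) e0 e1 => g0 g1.
have {}g0 : (1 - t) * (2 * fs_dist p x0) ^+ 2 <= (1 - t) * ((2 * (t * fs_dist x0 x1)) ^+ 2 + (2 * fs_dist p xt) ^+ 2
 - 2 * (2 * (t * fs_dist x0 x1)) * (2 * fs_dist p xt) * k0) by apply: ler_wpM2l => //; lra.
have {}g1 : t * (2 * fs_dist p x1) ^+ 2 <= t * ((2 * ((1 - t) * fs_dist x0 x1)) ^+ 2 + (2 * fs_dist p xt) ^+ 2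
 - 2 * (2 * ((1 - t) * fs_dist x0 x1)) * (2 * fs_dist p xt) * - k0) by apply: ler_wpM2l => //; lra.
lra.
Qed.

(* Three applications of [fs_nonneg_curvature]. *)
Lemma fs_geodesic_gap (R : realType) (x0 xt x1 y0 yt y1 : cp1 R) (t : R) : 0 < t < 1 ->
  fs_dist x0 xt = t * fs_dist x0 x1 -> fs_dist xt x1 = (1 - t) * fs_dist x0 x1 ->
  fs_dist y0 yt = t * fs_dist y0 y1 -> fs_dist yt y1 = (1 - t) * fs_dist y0 y1 ->
  fs_dist x0 x1 ^+ 2 + fs_dist y0 y1 ^+ 2 <= fs_dist x0 y1 ^+ 2 + fs_dist y0 x1 ^+ 2 ->
  (1 - t) ^+ 2 * fs_dist x0 y0 ^+ 2 + t ^+ 2 * fs_dist x1 y1 ^+ 2 <= fs_dist xt yt ^+ 2.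
Proof.
move=> t01 ex0 ex1 ey0 ey1 cm.
have h1 := @fs_nonneg_curvature R x0 xt x1 yt t t01 ex0 ex1.
have h2 := @fs_nonneg_curvature R y0 yt y1 x0 t t01 ey0 ey1.
have h3 := @fs_nonneg_curvature R y0 yt y1 x1 t t01 ey0 ey1.
have /andP[t0 t1] := t01.
rewrite (fs_sym xt yt); apply: le_trans h1.
rewrite (fs_sym yt x0) (fs_sym yt x1).
have {}h2 : (1 - t) * ((1 - t) * fs_dist x0 y0 ^+ 2 + t * fs_dist x0 y1 ^+ 2 -
     t * (1 - t) * fs_dist y0 y1 ^+ 2) <= (1 - t) * fs_dist x0 yt ^+ 2.
  by apply: ler_wpM2l => //; lra.
have {}h3 : t * ((1 - t) * fs_dist x1 y0 ^+ 2 + t * fs_dist x1 y1 ^+ 2 -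
     t * (1 - t) * fs_dist y0 y1 ^+ 2) <= t * fs_dist x1 yt ^+ 2.
  by apply: ler_wpM2l => //; lra.
(* The terms left over from the three inequalities are [t (1 - t)] times the difference of the two
   sides of the monotonicity hypothesis. *)
have : t * (1 - t) * (fs_dist x0 x1 ^+ 2 + fs_dist y0 y1 ^+ 2) <=
  t * (1 - t) * (fs_dist x0 y1 ^+ 2 + fs_dist y0 x1 ^+ 2).
  by apply: ler_wpM2l => //; rewrite mulr_ge0//; lra.
rewrite (fs_sym y0 x1); lra.
Qed.

Lemma fs_le_sin (R : realType) (z w : cp1 R) : fs_dist z w <= pi / 2 * sin (fs_dist z w).
Proof.
have := @sin_chord R (fs_dist z w) (pi / 2) (fs_ge0 z w) (fs_le z w).
by rewrite sin_pihalf mulr1; apply; have := @pi_gt0 R; lra.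
Qed.

(** * Finite optimal transport *)

Section FiniteTransport.
Variables (R : realType) (T : eqType) (D : T -> T -> R).
Implicit Types (S : seq T) (m : T -> R) (f g h : T -> T -> R).

(** A plan as a matrix extended by zero. Unlike the lists of [is_coupling], such plans give one mass
    to each pair and form a compact set. *)
Definition coupling S1 m1 S2 m2 f : Prop :=
  [/\ forall x y, 0 <= f x y,
      forall x y, ~~ ((x \in S1) && (y \in S2)) -> f x y = 0,
      forall x, x \in S1 -> \sum_(y <- S2) f x y = m1 x &
      forall y, y \in S2 -> \sum_(x <- S1) f x y = m2 y].

Definition cost S1 S2 f : R := \sum_(x <- S1) \sum_(y <- S2) f x y * D x y ^+ 2.

Definition optimal S1 m1 S2 m2 f :=
  coupling S1 m1 S2 m2 f /\
  forall g, coupling S1 m1 S2 m2 g -> cost S1 S2 f <= cost S1 S2 g.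

Lemma coupling_supp S1 m1 S2 m2 f x y : coupling S1 m1 S2 m2 f -> 0 < f x y ->
  x \in S1 /\ y \in S2.
Proof.
move=> [_ f0 _ _] fxy; apply/andP; apply/negPn/negP => /f0 e.
by rewrite e ltxx in fxy.
Qed.

Lemma coupling_exl S1 m1 S2 m2 f y : coupling S1 m1 S2 m2 f -> y \in S2 ->
  0 < m2 y -> exists x, 0 < f x y.
Proof.
move=> [f0 _ _ fm] yS; rewrite -fm// => s0; apply: contrapT => /forallNP h.
move: s0; rewrite big1 ?ltxx// => x _.
by apply/eqP; rewrite eq_le f0 andbT leNgt; apply/negP/h.
Qed.

Lemma coupling_exr S1 m1 S2 m2 f x : coupling S1 m1 S2 m2 f -> x \in S1 ->
  0 < m1 x -> exists y, 0 < f x y.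
Proof.
move=> [f0 _ fm _] yS; rewrite -fm// => s0; apply: contrapT => /forallNP h.
move: s0; rewrite big1 ?ltxx// => y _.
by apply/eqP; rewrite eq_le f0 andbT leNgt; apply/negP/h.
Qed.

Lemma sum_delta (S : seq T) z (F : T -> R) : uniq S -> z \in S ->
  \sum_(b <- S) (b == z)%:R * F b = F z.
Proof.
move=> uS zS; rewrite (bigD1_seq z)//= eqxx mul1r big1 ?addr0// => b /negbTE ->.
by rewrite mul0r.
Qed.

(* Moving mass [e] from [(x, z)] and [(x', z')] to [(x, z')] and [(x', z)]. *)
Lemma optimal_monotone S1 m1 S2 m2 h x z x' z' : uniq S1 -> uniq S2 ->
  optimal S1 m1 S2 m2 h -> 0 < h x z -> 0 < h x' z' ->
  D x z ^+ 2 + D x' z' ^+ 2 <= D x z' ^+ 2 + D x' z ^+ 2.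
Proof.
move=> u1 u2 [hc hopt] hxz hxz'.
have [xS zS] := coupling_supp hc hxz; have [xS' zS'] := coupling_supp hc hxz'.
pose e := Num.min (h x z) (h x' z').
have e0 : 0 < e by rewrite lt_min hxz.
pose A (a : T) : R := (a == x)%:R - (a == x')%:R.
pose B (b : T) : R := (b == z')%:R - (b == z)%:R.
pose h' a b := h a b + e * (A a * B b).
have sA F : \sum_(a <- S1) A a * F a = F x - F x'.
  rewrite -(sum_delta F u1 xS) -(sum_delta F u1 xS') -sumrB.
  by apply: eq_bigr => a _; rewrite /A mulrBl.
have sB F : \sum_(a <- S2) B a * F a = F z' - F z.
  rewrite -(sum_delta F u2 zS) -(sum_delta F u2 zS') -sumrB.
  by apply: eq_bigr => a _; rewrite /B mulrBl.
case: (hc) => h0 hs hm1 hm2.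
have h'c : coupling S1 m1 S2 m2 h'.
  split.
  - move=> a b; rewrite /h' /A /B.
    have el : e <= h x z by rewrite ge_min lexx.
    have el' : e <= h x' z' by rewrite ge_min lexx orbT.
    have := h0 a b.
    case: (eqVneq a x) => [ax|_]; case: (eqVneq a x') => [ax'|_];
    case: (eqVneq b z') => [bz'|_]; case: (eqVneq b z) => [bz|_] /=; try lra.
      by rewrite ax bz; lra.
    by rewrite ax' bz'; lra.
  - move=> a b ab; rewrite /h' hs// add0r.
    have [aS|aS] := boolP (a \in S1).
      have bS : b \notin S2 by move: ab; rewrite aS.
      have /negbTE e1 : b != z by apply: contraNneq bS => ->.
      have /negbTE e2 : b != z' by apply: contraNneq bS => ->.
      by rewrite /B e1 e2 subrr !mulr0.
    have /negbTE e1 : a != x by apply: contraNneq aS => ->.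
    have /negbTE e2 : a != x' by apply: contraNneq aS => ->.
    by rewrite /A e1 e2 subrr mul0r mulr0.
  - move=> a aS; rewrite big_split/= hm1// -mulr_sumr -mulr_sumr.
    have := sB (fun=> 1); under eq_bigr do rewrite mulr1.
    by move=> ->; rewrite subrr !mulr0 addr0.
  - move=> b bS; rewrite big_split/= hm2// -mulr_sumr.
    by rewrite (sA (fun=> B b)) subrr mulr0 addr0.
have := hopt _ h'c.
have -> : cost S1 S2 h' = cost S1 S2 h +
   e * (D x z' ^+ 2 + D x' z ^+ 2 - (D x z ^+ 2 + D x' z' ^+ 2)).
  rewrite /cost /h'.
  under eq_bigr => a _ do under eq_bigr => b _ do rewrite mulrDl.
  under eq_bigr => a _ do rewrite big_split/=.
  rewrite big_split/=; congr (_ + _).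
  transitivity (e * \sum_(a <- S1) A a * (\sum_(b <- S2) B b * D a b ^+ 2)).
    rewrite mulr_sumr; apply: eq_bigr => a _.
    by rewrite !mulr_sumr; apply: eq_bigr => b _; rewrite !mulrA.
  rewrite sA !sB; congr (_ * _); ring.
by rewrite lerDl pmulr_rge0// subr_ge0.
Qed.

Section Gluing.
Variables (S0 S1 S2 : seq T) (m0 m1 m2 : T -> R) (f g : T -> T -> R).
Hypotheses (fc : coupling S0 m0 S1 m1 f) (gc : coupling S1 m1 S2 m2 g).
Hypothesis m1_gt0 : forall y, y \in S1 -> 0 < m1 y.

(** The usual gluing over the middle marginal: given the middle point [y], the two ends are
    independent. *)
Definition gluing x z : R := \sum_(y <- S1) f x y * g y z / m1 y.

Lemma glue_coupling : coupling S0 m0 S2 m2 gluing.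
Proof.
case: (fc) => f0 fs f1 f2; case: (gc) => g0 gs g1 g2; split.
- move=> x z; rewrite /gluing big_seq; apply: sumr_ge0 => y yS.
  by rewrite divr_ge0 ?mulr_ge0// ltW// m1_gt0.
- move=> x z xz; rewrite /gluing big1// => y _.
  have [xS|xS] := boolP (x \in S0).
    by rewrite gs ?mulr0 ?mul0r// negb_and; move: xz; rewrite xS/= => ->; rewrite orbT.
  by rewrite fs ?mul0r// (negbTE xS).
- move=> x xS; rewrite /gluing exchange_big/= -f1// big_seq [RHS]big_seq.
  apply: eq_bigr => y yS; rewrite -mulr_suml -mulr_sumr g1//.
  by rewrite mulfK// gt_eqF// m1_gt0.
- move=> z zS; rewrite /gluing exchange_big/= -g2// big_seq [RHS]big_seq.
  apply: eq_bigr => y yS; rewrite -mulr_suml -mulr_suml f2//.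
  by rewrite mulrAC mulfV ?mul1r// gt_eqF// m1_gt0.
Qed.

Lemma glue_gt0 x y z : 0 < f x y -> 0 < g y z -> 0 < gluing x z.
Proof.
move=> fxy gyz; have [_ yS] := coupling_supp fc fxy.
case: (fc) => f0 _ _ _; case: (gc) => g0 _ _ _.
have t0 : 0 < f x y * g y z / m1 y by rewrite divr_gt0 ?mulr_gt0 ?m1_gt0.
apply: (lt_le_trans t0); rewrite /gluing (big_rem y)//= lerDl big_seq.
apply: sumr_ge0 => y' y'S; rewrite divr_ge0 ?mulr_ge0// ltW// m1_gt0//.
exact: mem_rem y'S.
Qed.

Lemma glue_supp x z : 0 < gluing x z -> exists2 y, 0 < f x y & 0 < g y z.
Proof.
move=> h; apply: contrapT => H; move: h; rewrite /gluing big_seq big1 ?ltxx// => y yS.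
case: (fc) => f0 _ _ _; case: (gc) => g0 _ _ _.
have [/eqP ->|fN] := boolP (f x y == 0); first by rewrite !mul0r.
have [/eqP ->|gN] := boolP (g y z == 0); first by rewrite mulr0 mul0r.
by exfalso; apply: H; exists y; rewrite lt_neqAle eq_sym ?fN ?gN ?f0 ?g0.
Qed.

Variables (a b W : R).
Hypotheses (a0 : 0 < a) (b0 : 0 < b).
Hypotheses (fW : cost S0 S1 f = (a * W) ^+ 2) (gW : cost S1 S2 g = (b * W) ^+ 2).
Hypothesis hW : forall h, coupling S0 m0 S2 m2 h -> ((a + b) * W) ^+ 2 <= cost S0 S2 h.
Hypothesis D_ge0 : forall x y, 0 <= D x y.
Hypothesis D_triangle : forall x y z, D x z <= D x y + D y z.

Let w x y z : R := f x y * g y z / m1 y.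
(** Being linear in the three squared distances, [G] sums up to transport costs; by [GE] it is also
    a sum of two nonnegative terms, which vanish together exactly when [y] divides the distance from
    [x] to [z] in the ratio [a : b]. *)
Let G x y z : R := (a + b) * b * D x y ^+ 2 + (a + b) * a * D y z ^+ 2 - a * b * D x z ^+ 2.

Let GE x y z : G x y z = a * b * ((D x y + D y z) ^+ 2 - D x z ^+ 2)
   + (b * D x y - a * D y z) ^+ 2.
Proof. rewrite /G; ring. Qed.

Let sq_ge0 x y z : 0 <= (D x y + D y z) ^+ 2 - D x z ^+ 2.
Proof.
by rewrite subr_ge0 ler_pXn2r// ?nnegrE ?addr_ge0.
Qed.

Let G_ge0 x y z : 0 <= G x y z.
Proof. by rewrite GE addr_ge0 ?sqr_ge0// mulr_ge0 ?mulr_ge0// ltW. Qed.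

Let w_ge0 x y z : y \in S1 -> 0 <= w x y z.
Proof.
case: (fc) => f0 _ _ _; case: (gc) => g0 _ _ _ yS.
by rewrite divr_ge0 ?mulr_ge0// ltW// m1_gt0.
Qed.

Let sumG : \sum_(y <- S1) \sum_(x <- S0) \sum_(z <- S2) w x y z * G x y z =
  a * b * (((a + b) * W) ^+ 2 - cost S0 S2 gluing).
Proof.
case: (fc) => f0 fs f1 f2; case: (gc) => g0 gs g1 g2.
have e1 : \sum_(y <- S1) \sum_(x <- S0) \sum_(z <- S2) w x y z * D x y ^+ 2 = (a * W) ^+ 2.
  rewrite -fW /cost exchange_big/=; apply: eq_bigr => x _.
  rewrite big_seq [RHS]big_seq; apply: eq_bigr => y yS.
  rewrite -mulr_suml; congr (_ * _).
  by rewrite /w -mulr_suml -mulr_sumr g1// mulfK// gt_eqF// m1_gt0.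
have e2 : \sum_(y <- S1) \sum_(x <- S0) \sum_(z <- S2) w x y z * D y z ^+ 2 = (b * W) ^+ 2.
  rewrite -gW /cost big_seq [RHS]big_seq; apply: eq_bigr => y yS.
  rewrite exchange_big/=; apply: eq_bigr => z _.
  rewrite -mulr_suml; congr (_ * _).
  by rewrite /w -!mulr_suml f2// mulrAC mulfV ?mul1r// gt_eqF// m1_gt0.
have e3 : \sum_(y <- S1) \sum_(x <- S0) \sum_(z <- S2) w x y z * D x z ^+ 2 = cost S0 S2 gluing.
  rewrite exchange_big/=; apply: eq_bigr => x _.
  rewrite exchange_big/=; apply: eq_bigr => z _.
  by rewrite -mulr_suml.
transitivity ((a + b) * b * (a * W) ^+ 2 + (a + b) * a * (b * W) ^+ 2 - a * b * cost S0 S2 gluing);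
  last by ring.
rewrite -e1 -e2 -e3 !mulr_sumr -big_split -sumrB; apply: eq_bigr => y _ /=.
rewrite !mulr_sumr -big_split -sumrB; apply: eq_bigr => x _ /=.
rewrite !mulr_sumr -big_split -sumrB; apply: eq_bigr => z _ /=.
rewrite /G; ring.
Qed.

Let sumG_le0 : \sum_(y <- S1) \sum_(x <- S0) \sum_(z <- S2) w x y z * G x y z <= 0.
Proof.
by rewrite sumG pmulr_rle0 ?mulr_gt0// subr_le0 hW//; exact: glue_coupling.
Qed.

Let sum_ge0 y : y \in S1 -> 0 <= \sum_(x <- S0) \sum_(z <- S2) w x y z * G x y z.
Proof.
by move=> yS; apply: sumr_ge0 => x _; apply: sumr_ge0 => z _; rewrite mulr_ge0 ?w_ge0.
Qed.

Lemma glue_cost : cost S0 S2 gluing = ((a + b) * W) ^+ 2.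
Proof.
apply/eqP; rewrite eq_le hW ?andbT; last exact: glue_coupling.
rewrite -subr_ge0 -(@pmulr_rge0 _ (a * b)) ?mulr_gt0// -sumG big_seq.
by apply: sumr_ge0 => y; exact: sum_ge0.
Qed.

Lemma glue_optimal : optimal S0 m0 S2 m2 gluing.
Proof. by split=> [|h hc]; [exact: glue_coupling|rewrite glue_cost hW]. Qed.

(** The glued plan cannot cost less than the bound [hW], so the sum of all [w * G] is at most zero.
    Its terms are nonnegative, hence [G] vanishes on each triple of positive weight. *)
Lemma glue_between x y z : 0 < f x y -> 0 < g y z ->
  D x z = D x y + D y z /\ b * D x y = a * D y z.
Proof.
move=> fxy gyz.
have [xS yS] := coupling_supp fc fxy; have [_ zS] := coupling_supp gc gyz.
have t0 : 0 < w x y z by rewrite divr_gt0 ?mulr_gt0 ?m1_gt0.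
have G0 : G x y z = 0.
  have := sumG_le0; rewrite big_seq => s0.
  have {s0} /eqP : \sum_(y <- S1 | y \in S1) \sum_(x <- S0) \sum_(z <- S2) w x y z * G x y z == 0.
    by rewrite eq_le s0 sumr_ge0// => y'; exact: sum_ge0.
  move/eqP; rewrite psumr_eq0 => [/allP/(_ y yS)|y']; last exact: sum_ge0.
  rewrite yS/= psumr_eq0 => [/allP/(_ x xS)|x' _]; last first.
    by apply: sumr_ge0 => z' _; rewrite mulr_ge0 ?w_ge0.
  rewrite /= psumr_eq0 => [/allP/(_ z zS)|z' _]; last by rewrite mulr_ge0 ?w_ge0.
  by rewrite /= mulf_eq0 gt_eqF//= => /eqP.
move/eqP: G0; rewrite GE paddr_eq0 ?sqr_ge0//; last by rewrite !mulr_ge0// ltW.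
rewrite mulf_eq0 gt_eqF ?mulr_gt0//= subr_eq0 sqrf_eq0 subr_eq0 => /andP[h1 /eqP h2].
split=> //; apply/eqP; rewrite eq_sym.
by rewrite eqrXn2 ?addr_ge0// in h1.
Qed.
End Gluing.
End FiniteTransport.

(** * Existence of optimal plans *)

Section OptimalExists.
Variables (R : realType) (T : eqType) (D : T -> T -> R).
Implicit Types (S : seq T) (m : T -> R).

Definition eval_sum (I : eqType) (J : Type) (i : J -> I) (c : J -> R) (s : seq J)
  (u : {ptws I -> R}) : R := \sum_(j <- s) u (i j) * c j.

Lemma continuous_affine (X : topologicalType) (u v : X -> R) (c : R) :
  continuous u -> continuous v -> continuous (fun x => u x * c + v x).
Proof.
by move=> cu cv x; apply: cvgD; [apply: cvgM; [exact: cu|exact: cvg_cst]|exact: cv].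
Qed.

Lemma continuous_eval_sum (I : eqType) (J : Type) (i : J -> I) (c : J -> R) (s : seq J) :
  continuous (eval_sum i c s).
Proof.
elim: s => [|j s IH].
  have -> : eval_sum i c [::] = fun=> 0 by apply/funext => v; rewrite /eval_sum big_nil.
  exact: cst_continuous.
have -> : eval_sum i c (j :: s) = fun v => v (i j) * c j + eval_sum i c s v.
  by apply/funext => v; rewrite /eval_sum big_cons.
apply: continuous_affine IH; exact: (@proj_continuous I (fun=> R) (i j)).
Qed.

(** Compactness in the topology of pointwise convergence: masses lie in [[0, 1]], so Tychonoff
    applies, the marginal conditions are closed, the product plan shows that the set is nonempty,
    and the cost is a finite sum of evaluations. *)
Lemma optimal_exists S1 m1 S2 m2 :
  (forall x, 0 <= m1 x) -> (forall y, 0 <= m2 y) -> uniq S1 -> uniq S2 ->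
  \sum_(x <- S1) m1 x = 1 -> \sum_(y <- S2) m2 y = 1 ->
  exists f, optimal D S1 m1 S2 m2 f.
Proof.
move=> m10 m20 u1 u2 s1 s2.
pose X := {ptws T * T -> R}.
pose A (e : T * T) : set R :=
  if (e.1 \in S1) && (e.2 \in S2) then `[0, 1] else [set 0].
pose K : set X := [set u | forall e, A e (u e)].
have cK : compact K.
  apply: (@tychonoff (T * T)%type (fun=> R) A) => e.
  by rewrite /A; case: ifP => _; [exact: segment_compact|exact: compact_set1].
pose M1 : set X := \bigcap_(x in [set` S1])
  eval_sum (fun y => (x, y)) (fun=> 1) S2 @^-1` [set m1 x].
pose M2 : set X := \bigcap_(y in [set` S2])
  eval_sum (fun x => (x, y)) (fun=> 1) S1 @^-1` [set m2 y].
have clM1 : closed M1.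
  apply: closed_bigI => x _; apply: preimage_closed; last exact: closed_eq.
  by move=> u _; exact: continuous_eval_sum.
have clM2 : closed M2.
  apply: closed_bigI => y _; apply: preimage_closed; last exact: closed_eq.
  by move=> u _; exact: continuous_eval_sum.
have cKM : compact (K `&` (M1 `&` M2)).
  by apply: compact_closedI => //; exact: closedI.
pose c : X -> R := eval_sum id (fun e => D e.1 e.2 ^+ 2) [seq (x, y) | x <- S1, y <- S2].
have cc : continuous c by exact: continuous_eval_sum.
have costE u : cost D S1 S2 (fun x y => u (x, y)) = c u.
  by rewrite /c /eval_sum big_allpairs.
have KMP u : (K `&` (M1 `&` M2)) u <-> coupling S1 m1 S2 m2 (fun x y => u (x, y)).
  split.
    move=> [Ku [M1u M2u]]; split.
    - move=> x y; have := Ku (x, y); rewrite /A/=; case: ifP => _ /=; last by move=> ->.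
      by rewrite in_itv/= => /andP[].
    - by move=> x y /negbTE xy; have := Ku (x, y); rewrite /A/= xy.
    - by move=> x xS; have /= <- := M1u x xS; apply: eq_bigr => ? _; rewrite mulr1.
    - by move=> y yS; have /= <- := M2u y yS; apply: eq_bigr => ? _; rewrite mulr1.
  move=> [u0 us um1 um2]; split; last split.
  - move=> [x y]; rewrite /A/=; case: ifP => [/andP[xS yS]|/negbT/us //].
    rewrite /= in_itv/= u0/=.
    apply: (@le_trans _ _ (m1 x)).
      by rewrite -um1// (bigD1_seq y)//= lerDl sumr_ge0.
    by rewrite -s1 (bigD1_seq x)//= lerDl sumr_ge0.
  - by move=> x xS /=; rewrite -um1//; apply: eq_bigr => ? _; rewrite mulr1.
  - by move=> x xS /=; rewrite -um2//; apply: eq_bigr => ? _; rewrite mulr1.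
have KM0 : K `&` (M1 `&` M2) !=set0.
  exists (fun e => if (e.1 \in S1) && (e.2 \in S2) then m1 e.1 * m2 e.2 else 0).
  apply/KMP; split => /=.
  - by move=> x y; case: ifP => // _; rewrite mulr_ge0.
  - by move=> x y /negbTE ->.
  - move=> x xS; rewrite -[RHS]mulr1 -s2 mulr_sumr big_seq [RHS]big_seq.
    by apply: eq_bigr => y ->; rewrite xS.
  - move=> y yS; rewrite -[RHS]mul1r -s1 mulr_suml big_seq [RHS]big_seq.
    by apply: eq_bigr => x ->; rewrite yS.
have [u uK umin] := compact_EVT_min KM0 cKM (continuous_subspaceT cc).
exists (fun x y => u (x, y)); split; first by apply/KMP; rewrite inE in uK.
move=> g gc; rewrite costE.
have -> : cost D S1 S2 g = c (fun e => g e.1 e.2) by rewrite -costE.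
by apply: umin; rewrite inE; apply/KMP.
Qed.
End OptimalExists.

(** * From couplings as lists to couplings as matrices *)

Section W2link.
Variable R : realType.
Implicit Types (S : seq (cp1 R)) (m : cp1 R -> R).

Lemma coupling_list S1 m1 S2 m2 f : uniq S1 -> uniq S2 ->
  (forall z, z \notin S1 -> m1 z = 0) -> (forall z, z \notin S2 -> m2 z = 0) ->
  coupling S1 m1 S2 m2 f -> exists L, is_coupling m1 m2 L /\ tcost L = cost (@fs_dist R) S1 S2 f.
Proof.
move=> u1 u2 n1 n2 [f0 fs f1 f2].
exists [seq ((x, y), f x y) | x <- S1, y <- S2]; split; last first.
  by rewrite /tcost big_allpairs_dep.
split.
- by move=> e /allpairsP[[x y] [_ _ ->]] /=.
- move=> z; rewrite big_mkcond big_allpairs_dep/=.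
  have [zS|zS] := boolP (z \in S1); last first.
    rewrite n1// big_seq big1// => x xS; rewrite big1// => y _.
    by case: eqP => // xz; rewrite -xz xS in zS.
  rewrite (bigD1_seq z)//= [X in _ + X]big1 ?addr0.
    by rewrite -f1//; apply: eq_bigr => y _; rewrite eqxx.
  by move=> x /negbTE xz; rewrite big1// => y _; rewrite xz.
- move=> z; rewrite big_mkcond big_allpairs_dep/= exchange_big/=.
  have [zS|zS] := boolP (z \in S2); last first.
    rewrite n2// big_seq big1// => x xS; rewrite big1// => y _.
    by case: eqP => // xz; rewrite -xz xS in zS.
  rewrite (bigD1_seq z)//= [X in _ + X]big1 ?addr0.
    by rewrite -f2//; apply: eq_bigr => y _; rewrite eqxx.
  by move=> x /negbTE xz; rewrite big1// => y _; rewrite xz.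
Qed.

Lemma list_coupling S1 m1 S2 m2 L : uniq S1 -> uniq S2 ->
  (forall z, z \notin S1 -> m1 z = 0) -> (forall z, z \notin S2 -> m2 z = 0) ->
  is_coupling m1 m2 L -> exists f, coupling S1 m1 S2 m2 f /\ tcost L = cost (@fs_dist R) S1 S2 f.
Proof.
move=> u1 u2 n1 n2 [L0 L1 L2].
(* An entry with an end outside the support has weight zero, since nonnegative weights add up to the
   mass zero there. Such entries may be dropped when [L] is collected into a matrix. *)
have z1 e : e \in L -> e.1.1 \notin S1 -> e.2 = 0.
  move=> eL eS; have := L1 e.1.1; rewrite n1// => /eqP.
  rewrite big_seq_cond psumr_eq0 => [/allP/(_ e eL)|e']; last by move=> /andP[/L0].
  by rewrite eL eqxx/= => /eqP.
have z2 e : e \in L -> e.1.2 \notin S2 -> e.2 = 0.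
  move=> eL eS; have := L2 e.1.2; rewrite n2// => /eqP.
  rewrite big_seq_cond psumr_eq0 => [/allP/(_ e eL)|e']; last by move=> /andP[/L0].
  by rewrite eL eqxx/= => /eqP.
have fE (F : cp1 R -> cp1 R -> R) x y : (\sum_(e <- L | e.1 == (x, y)) e.2) * F x y =
   \sum_(e <- L) (y == e.1.2)%:R * ((x == e.1.1)%:R * e.2 * F e.1.1 e.1.2).
  rewrite mulr_suml big_mkcond; apply: eq_bigr => -[[x' y'] k] _ /=.
  rewrite xpair_eqE eq_sym [y' == _]eq_sym.
  by have [->|] := eqVneq x x'; have [->|] := eqVneq y y'; rewrite /= ?mul0r ?mulr0 ?mul1r.
have fE1 x y : \sum_(e <- L | e.1 == (x, y)) e.2 =
   \sum_(e <- L) (y == e.1.2)%:R * ((x == e.1.1)%:R * e.2).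
  by rewrite -[LHS]mulr1 (fE (fun _ _ => 1)); apply: eq_bigr => e _; rewrite mulr1.
exists (fun x y => \sum_(e <- L | e.1 == (x, y)) e.2); split; first split.
- by move=> x y; rewrite big_seq_cond; apply: sumr_ge0 => e /andP[/L0].
- move=> x y; rewrite negb_and => xy; rewrite big_seq_cond big1// => e /andP[eL /eqP exy].
  by case/orP: xy => h; [apply: z1|apply: z2]; rewrite ?exy.
- move=> x xS; rewrite -L1.
  under eq_bigr => y _ do rewrite fE1.
  rewrite exchange_big/= [RHS]big_mkcond/= big_seq [RHS]big_seq.
  apply: eq_bigr => e eL.
  have [eS|eS] := boolP (e.1.2 \in S2).
    by rewrite (sum_delta _ u2 eS) eq_sym; case: eqP; rewrite ?mul1r ?mul0r.
  by rewrite z2// big1 ?if_same// => i _; rewrite !(mulr0, mul0r).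
- move=> y yS; rewrite -L2.
  under eq_bigr => x _ do rewrite fE1.
  rewrite exchange_big/= [RHS]big_mkcond/= big_seq [RHS]big_seq.
  apply: eq_bigr => e eL.
  have [eS|eS] := boolP (e.1.1 \in S1).
    by rewrite -mulr_sumr (sum_delta (fun=> e.2) u1 eS) eq_sym; case: eqP; rewrite ?mul1r ?mul0r.
  by rewrite z1// big1 ?if_same// => i _; rewrite !(mulr0, mul0r).
- rewrite /tcost /cost.
  under [RHS]eq_bigr => x _ do under eq_bigr => y _ do rewrite (fE (fun x y => fs_dist x y ^+ 2)).
  under [RHS]eq_bigr => x _ do rewrite exchange_big/=.
  rewrite exchange_big/= big_seq [RHS]big_seq.
  apply: eq_bigr => e eL.
  have [eS1|eS1] := boolP (e.1.1 \in S1); last first.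
    rewrite z1// mul0r big1// => i _; rewrite big1// => j _; rewrite !(mulr0, mul0r)//.
  have [eS2|eS2] := boolP (e.1.2 \in S2); last first.
    rewrite z2// mul0r big1// => i _; rewrite big1// => j _; rewrite !(mulr0, mul0r)//.
  under eq_bigr => i _ do rewrite (sum_delta _ u2 eS2) -mulrA.
  by rewrite (sum_delta _ u1 eS1).
Qed.

(** Makes the infimum in [W2] an attained minimum over matrices; the geodesic hypothesis is
    exploited through these two facts. *)
Lemma W2_optimal S1 m1 S2 m2 : uniq S1 -> uniq S2 ->
  (forall z, z \notin S1 -> m1 z = 0) -> (forall z, z \notin S2 -> m2 z = 0) ->
  (forall x, 0 <= m1 x) -> (forall y, 0 <= m2 y) ->
  \sum_(x <- S1) m1 x = 1 -> \sum_(y <- S2) m2 y = 1 ->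
  (forall h, coupling S1 m1 S2 m2 h -> W2 m1 m2 ^+ 2 <= cost (@fs_dist R) S1 S2 h) /\
  (exists2 f, coupling S1 m1 S2 m2 f & cost (@fs_dist R) S1 S2 f = W2 m1 m2 ^+ 2).
Proof.
move=> u1 u2 n1 n2 p1 p2 s1 s2.
have [f [fc fo]] := optimal_exists (@fs_dist R) p1 p2 u1 u2 s1 s2.
have [L [Lc Lf]] := coupling_list u1 u2 n1 n2 fc.
set E := [set c | exists L, is_coupling m1 m2 L /\ c = tcost L].
have infE : inf E = cost (@fs_dist R) S1 S2 f.
  have lb : lbound E (cost (@fs_dist R) S1 S2 f).
    move=> c [L' [Lc' ->]]; have [g [gc ->]] := list_coupling u1 u2 n1 n2 Lc'.
    exact: fo.
  have EL : E (cost (@fs_dist R) S1 S2 f) by exists L; rewrite Lf.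
  apply/eqP; rewrite eq_le; apply/andP; split.
    by apply: ge_inf => //; exists (cost (@fs_dist R) S1 S2 f).
  by apply: lb_le_inf => //; exists (cost (@fs_dist R) S1 S2 f).
have c0 : 0 <= cost (@fs_dist R) S1 S2 f.
  case: fc => f0 _ _ _; apply: sumr_ge0 => x _; apply: sumr_ge0 => y _.
  by rewrite mulr_ge0 ?sqr_ge0.
rewrite /W2 -/E infE sqr_sqrtr//; split; first exact: fo.
by exists f.
Qed.
End W2link.

(** * Binary forms and their roots *)

Section Cabs.
Variable R : realType.
Local Notation C := R[i].
Implicit Types (x y : C).

Lemma cabsE x : (cabs x)%:C%C = `|x|.
Proof. by rewrite normc_def. Qed.

Lemma cabsM x y : cabs (x * y) = cabs x * cabs y.
Proof. by apply: complexI; rewrite rmorphM/= !cabsE normrM. Qed.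

Lemma cabsD x y : cabs (x + y) <= cabs x + cabs y.
Proof. by rewrite -lecR rmorphD/= !cabsE ler_normD. Qed.

Lemma cabsN x : cabs (- x) = cabs x.
Proof. by apply: complexI; rewrite !cabsE normrN. Qed.

Lemma cabsB x y : cabs (x - y) <= cabs x + cabs y.
Proof. by rewrite -(cabsN y) cabsD. Qed.

Lemma cabs0 : cabs (0 : C) = 0.
Proof. by apply: complexI; rewrite cabsE normr0. Qed.

Lemma cabs1 : cabs (1 : C) = 1.
Proof. by apply: complexI; rewrite cabsE normr1. Qed.

Lemma cabsV x : cabs (x^-1) = (cabs x)^-1.
Proof. by apply: complexI; rewrite fmorphV/= !cabsE normfV. Qed.

Lemma cabs_real (r : R) : 0 <= r -> cabs (r%:C)%C = r.
Proof. by move=> r0; rewrite /cabs/= expr0n/= addr0 sqrtr_sqr ger0_norm. Qed.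

Lemma cabs_conj x : cabs (conjc x) = cabs x.
Proof. by apply: complexI; rewrite !cabsE normcJ. Qed.

Lemma cabs_gt0 x : x != 0 -> 0 < cabs x.
Proof.
by move=> x0; rewrite lt_neqAle cabs_ge0 andbT eq_sym; apply: contraNneq x0 => /cabs_eq0 ->.
Qed.

Lemma cabs_prod (I : Type) (s : seq I) (F : I -> C) :
  cabs (\prod_(i <- s) F i) = \prod_(i <- s) cabs (F i).
Proof. by elim/big_ind2: _ => [|x a y b <- <-|]; rewrite ?cabs1 ?cabsM. Qed.

Lemma cabs_sum (I : Type) (s : seq I) (F : I -> C) :
  cabs (\sum_(i <- s) F i) <= \sum_(i <- s) cabs (F i).
Proof.
by elim/big_ind2: _ => [|x a y b ha hb|]; rewrite ?cabs0 ?(le_trans (cabsD _ _)) ?lerD.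
Qed.
End Cabs.

(** * Coefficient estimates for multiplication and division by linear forms *)

Section LinearForms.
Variable R : realType.
Local Notation C := R[i].
Implicit Types (P Q : {poly C}) (a b : C).

Definition lin b a : {poly C} := b *: 'X - a%:P.

(** Estimates are made for the largest coefficient, which behaves well under products with linear
    forms; [coef_le_bwnorm] and [bwnorm_coef_le] translate them to the Bombieri-Weyl norm. *)
Definition coef_le P (M : R) := forall k, cabs P`_k <= M.

Lemma lin_coef b a P k :
  (lin b a * P)`_k = (if k is j.+1 then b * P`_j else 0) - a * P`_k.
Proof.
rewrite /lin mulrBl coefB -scalerAl coefZ coefXM mul_polyC coefZ.
by case: k => [|k] /=; rewrite ?mulr0.
Qed.

Lemma coef_le_lin b a P (M s : R) : 0 <= s -> cabs a <= s -> cabs b <= s ->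
  coef_le P M -> coef_le (lin b a * P) (2 * s * M).
Proof.
move=> s0 ha hb hP k; rewrite lin_coef.
have M0 : 0 <= M := le_trans (cabs_ge0 _) (hP 0%N).
apply: (le_trans (cabsB _ _)); rewrite mulrDl mulrDl mul1r.
apply: lerD; last by rewrite cabsM ler_pM ?cabs_ge0.
by case: k => [|k]; rewrite ?cabs0 ?mulr_ge0// cabsM ler_pM ?cabs_ge0.
Qed.

Lemma coef_le_prod_lin (I : Type) (s : seq I) (b a : I -> C) P M :
  (forall i, cabs (a i) <= 1) -> (forall i, cabs (b i) <= 1) -> coef_le P M ->
  coef_le ((\prod_(i <- s) lin (b i) (a i)) * P) (2 ^+ size s * M).
Proof.
move=> ha hb hP; elim: s => [|i s IH]; first by rewrite big_nil mul1r expr0 mul1r.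
rewrite big_cons -mulrA /= exprS -mulrA -[X in coef_le _ (X * _)]mulr1.
exact: coef_le_lin.
Qed.

Lemma coef_le1 : coef_le 1 1.
Proof. by move=> k; rewrite coefC; case: eqP => _; rewrite ?cabs1 ?cabs0. Qed.

(** One of [cabs a], [cabs b] is at least [1 / 2]. If it is the former, the coefficients of [P] are
    recovered from the lowest upwards, otherwise from the highest downwards. A step turns a bound
    [Q >= M] into [2 (M + Q) <= 4 Q]. *)
Lemma coef_le_lin_inv b a P (M : R) n : cabs a ^+ 2 + cabs b ^+ 2 = 1 ->
  (size P <= n)%N -> coef_le (lin b a * P) M -> coef_le P (4 ^+ n * M).
Proof.
move=> ab sP hM.
have M0 : 0 <= M := le_trans (cabs_ge0 _) (hM 0%N).
have big k : (n <= k)%N -> cabs P`_k <= 4 ^+ n * M.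
  by move=> nk; rewrite nth_default ?(leq_trans sP nk)// cabs0 mulr_ge0// exprn_ge0.
have a0 := cabs_ge0 a; have b0 := cabs_ge0 b.
have [ha|ha] := leP (1 / 2) (cabs a).
  suff H k : cabs P`_k <= 4 ^+ k.+1 * M.
    move=> k; have [nk|kn] := leqP n k; first exact: big.
    apply: (le_trans (H k)); rewrite ler_wpM2r// ler_eXn2l//; lra.
  have step x : cabs (a * x) <= M + cabs (b * 0) -> cabs x <= 2 * M.
    by rewrite mulr0 cabs0 addr0 cabsM => h; have := cabs_ge0 x; nra.
  elim: k => [|k IH].
    apply: (le_trans (step _ _)); last by rewrite expr1; nra.
    have := hM 0%N; rewrite lin_coef sub0r cabsN => /le_trans; apply.
    by rewrite lerDl cabs_ge0.
  have h : cabs (a * P`_k.+1) <= M + cabs (b * P`_k).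
    have -> : a * P`_k.+1 = b * P`_k - (lin b a * P)`_k.+1 by rewrite lin_coef; ring.
    by rewrite (le_trans (cabsB _ _))// addrC lerD.
  rewrite !cabsM in h; rewrite exprS.
  have b1 : cabs b <= 1 by nra.
  have p1 : 1 <= (4 ^+ k.+1 : R) by rewrite exprn_ege1//; lra.
  have := cabs_ge0 P`_k.+1; have := cabs_ge0 P`_k => h0 h1.
  have hb : cabs b * cabs P`_k <= 4 ^+ k.+1 * M.
    by rewrite -[leRHS]mul1r ler_pM.
  have : M <= 4 ^+ k.+1 * M by rewrite ler_peMl.
  set Q := 4 ^+ k.+1 * M in hb *; rewrite -mulrA -/Q => hQ; nra.
have hb : 1 / 2 <= cabs b by nra.
suff H j : (j <= n)%N -> cabs P`_(n - j) <= 4 ^+ j * M.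
  move=> k; have [nk|kn] := leqP n k; first exact: big.
  have := H (n - k)%N (leq_subr _ _); rewrite subKn 1?ltnW// => /le_trans; apply.
  by rewrite ler_wpM2r// ler_eXn2l ?leq_subr//; lra.
elim: j => [|j IH] jn.
  by rewrite subn0 nth_default// cabs0 mulr_ge0 ?exprn_ge0.
have {}IH := IH (ltnW jn).
have e : (n - j = (n - j.+1).+1)%N by rewrite subnSK.
rewrite e in IH; set k := (n - j.+1)%N in IH *.
have h : cabs (b * P`_k) <= M + cabs (a * P`_k.+1).
  have -> : b * P`_k = (lin b a * P)`_k.+1 + a * P`_k.+1 by rewrite lin_coef; ring.
  by rewrite (le_trans (cabsD _ _))// lerD.
rewrite !cabsM in h; rewrite exprS.
have a1 : cabs a <= 1 by nra.
have p1 : 1 <= (4 ^+ j : R) by rewrite exprn_ege1//; lra.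
have := cabs_ge0 P`_k.+1; have := cabs_ge0 P`_k => h0 h1.
have ha' : cabs a * cabs P`_k.+1 <= 4 ^+ j * M.
  by rewrite -[leRHS]mul1r ler_pM.
have : M <= 4 ^+ j * M by rewrite ler_peMl.
set Q := 4 ^+ j * M in ha' *; rewrite -mulrA -/Q => hQ; nra.
Qed.

(* The form of degree [d] with coefficients [P] at [(U, V)]; polynomial arguments
   give access to its derivatives. *)
Definition hev d P (U V : {poly C}) : {poly C} :=
  \sum_(k < d.+1) P`_k *: (U ^+ k * V ^+ (d - k)).

Lemma hev_lin d P b a U V : (size P <= d.+1)%N ->
  hev d.+1 (lin b a * P) U V = (b *: U - a *: V) * hev d P U V.
Proof.
move=> sP; rewrite /hev.
under eq_bigr => k _ do rewrite lin_coef scalerBl.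
rewrite sumrB mulrBl; congr (_ - _).
  rewrite big_ord_recl/= scale0r add0r mulr_sumr; apply: eq_bigr => k _.
  rewrite subSS exprS -!scalerAl -!scalerAr scalerA; congr (_ *: _).
  by rewrite mulrA.
rewrite big_ord_recr/= (nth_default _ sP) mulr0 scale0r addr0 mulr_sumr.
apply: eq_bigr => k _; rewrite subSn; last by rewrite -ltnS.
rewrite exprS -!scalerAl -!scalerAr scalerA; congr (_ *: _).
by rewrite mulrCA.
Qed.

Lemma hevZ d P c U V : hev d (c *: P) U V = c *: hev d P U V.
Proof. by rewrite /hev scaler_sumr; apply: eq_bigr => k _; rewrite coefZ scalerA. Qed.

Lemma hevD d P Q U V : hev d (P + Q) U V = hev d P U V + hev d Q U V.
Proof. by rewrite /hev -big_split; apply: eq_bigr => k _; rewrite coefD scalerDl. Qed.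

Lemma hevN d P U V : hev d (- P) U V = - hev d P U V.
Proof. by rewrite -scaleN1r hevZ scaleN1r. Qed.

Lemma size_lin_mul b a P n : (size P <= n)%N -> (size (lin b a * P)%R <= n.+1)%N.
Proof.
move=> sP; apply/leq_sizeP => k nk; rewrite lin_coef.
case: k nk => // k nk; rewrite !nth_default ?mulr0 ?subr0//.
  exact: leq_trans sP (ltnW nk).
exact: leq_trans sP nk.
Qed.

Lemma size_prod_lin (I : Type) (s : seq I) (b a : I -> C) P n : (size P <= n)%N ->
  (size ((\prod_(i <- s) lin (b i) (a i)) * P)%R <= size s + n)%N.
Proof.
move=> sP; elim: s => [|i s IH]; first by rewrite big_nil mul1r.
by rewrite big_cons -mulrA addSn; exact: size_lin_mul.
Qed.

Lemma hev_prod_lin (I : Type) (s : seq I) (b a : I -> C) P d U V : (size P <= d.+1)%N ->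
  hev (size s + d) ((\prod_(i <- s) lin (b i) (a i)) * P) U V =
  (\prod_(i <- s) (b i *: U - a i *: V)) * hev d P U V.
Proof.
move=> sP; elim: s => [|i s IH]; first by rewrite !big_nil !mul1r.
rewrite !big_cons -!mulrA -IH addSn hev_lin// -addnS; exact: size_prod_lin.
Qed.

Lemma hev0 U V : hev 0 1 U V = 1.
Proof. by rewrite /hev big_ord1/= coefC/= !expr0 mulr1 scale1r. Qed.

Lemma coef_le_hev d P M u u' v v' : cabs u <= 1 -> cabs u' <= 1 -> cabs v <= 1 -> cabs v' <= 1 ->
  coef_le P M -> coef_le (hev d P (lin u' u) (lin v' v)) (d.+1%:R * (2 ^+ d * M)).
Proof.
move=> hu hu' hv hv' hP k; rewrite /hev coef_sum.
apply: (le_trans (cabs_sum _ _)).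
rewrite -[d.+1 in leRHS]card_ord mulr_natl -sumr_const; apply: ler_sum => i _.
rewrite coefZ cabsM mulrC ler_pM ?cabs_ge0//.
have h1 := coef_le_prod_lin (nseq (d - i) tt) (fun=> hv) (fun=> hv') coef_le1.
have h2 := coef_le_prod_lin (nseq i tt) (fun=> hu) (fun=> hu') h1.
have := h2 k; rewrite !big_nseq !iter_mulr_1 !size_nseq !mulr1 -exprD subnKC//.
by rewrite -ltnS.
Qed.
End LinearForms.

Section Roots.
Variable R : realType.
Local Notation C := R[i].
Variable d : nat.
Implicit Types (p q : bform R d) (z w : cp1 R) (rs : seq (cp1 R)).

Lemma coef_bpoly p (k : 'I_d.+1) : (bpoly p)`_k = p k.
Proof. by rewrite /bpoly coef_poly ltn_ord inord_val. Qed.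

Lemma size_bpoly p : (size (bpoly p) <= d.+1)%N.
Proof. exact: size_poly. Qed.

Lemma bpoly_coef (P : {poly C}) : (size P <= d.+1)%N -> bpoly (fun k : 'I_d.+1 => P`_k) = P.
Proof.
move=> sP; apply/polyP => k; rewrite coef_poly; case: ltnP => kd.
  by rewrite inordK.
by rewrite nth_default// (leq_trans sP).
Qed.

Lemma bpoly_inj p q : bpoly p = bpoly q -> p = q.
Proof. by move=> e; apply/funext => k; rewrite -!coef_bpoly e. Qed.

Lemma bpoly_neq0 p : p != (fun _ => 0) -> bpoly p != 0.
Proof.
apply: contraNneq => e; apply/eqP; apply: bpoly_inj; rewrite e.
by apply/polyP => k; rewrite coef_poly coef0; case: ifP.
Qed.

Lemma linfE z : linf z = lin (cp1rep z).2 (cp1rep z).1.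
Proof. by []. Qed.

Lemma linf_neq0 z : linf z != 0.
Proof.
apply/eqP => /polyP e; case: z e => [a|] e.
  have /eqP := e 1%N; rewrite coefB coefZ coefX coefC coef0/= mulr1 subr0.
  by rewrite oner_eq0.
have /eqP := e 0%N; rewrite coefB coefZ coefX coefC coef0/= mulr0 sub0r.
by rewrite oppr_eq0 oner_eq0.
Qed.

(* The roots of [p], each repeated according to its multiplicity. *)
Definition root_list p rs :=
  size rs = d /\ exists2 c : C, c != 0 & bpoly p = c *: \prod_(z <- rs) linf z.

Lemma root_list_exists p : p != (fun _ => 0) -> exists rs, root_list p rs.
Proof.
move=> /bpoly_neq0 p0; have [r rE] := closed_field_poly_normal (bpoly p).
have l0 : lead_coef (bpoly p) != 0 by rewrite lead_coef_eq0.
have sr : (size r <= d)%N.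
  by rewrite -ltnS -(size_prod_XsubC r id) -(size_scale _ l0) -rE size_bpoly.
exists (map Some r ++ nseq (d - size r) None); split.
  by rewrite size_cat size_map size_nseq subnKC.
(* The degree missing in the polynomial consists of roots at infinity, and [linf None] is the
   constant [-1]; the sign compensates for these factors. *)
exists (lead_coef (bpoly p) * (-1) ^+ (d - size r)); first by rewrite mulf_neq0// signr_eq0.
rewrite {1}rE big_cat/= big_map big_nseq iter_mulr_1 -scalerA; congr (_ *: _).
have -> : linf None = (-1)%:P :> {poly C} by rewrite /linf/= scale0r sub0r polyCN.
rewrite -rmorphXn/= mulrC mul_polyC scalerA -expr2 sqrr_sign scale1r.
by apply: eq_bigr => a _; rewrite /linf/= scale1r.
Qed.

Lemma hev_root (s : seq (cp1 R)) (u v : C) :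
  (hev (size s) (\prod_(w <- s) linf w) u%:P v%:P)`_0 =
  \prod_(w <- s) ((cp1rep w).2 * u - (cp1rep w).1 * v).
Proof.
have := @hev_prod_lin R _ s (fun w => (cp1rep w).2) (fun w => (cp1rep w).1) 1 0 u%:P v%:P.
rewrite size_poly1 => /(_ isT); rewrite addn0 mulr1 hev0 mulr1 => ->.
elim: s => [|w s IH]; first by rewrite !big_nil coefC.
by rewrite !big_cons coef0M IH coefB !coefZ !coefC.
Qed.

Lemma det_rep_eq0 z w :
  ((cp1rep w).2 * (cp1rep z).1 - (cp1rep w).1 * (cp1rep z).2 == 0) = (z == w).
Proof.
case: z => [a|]; case: w => [b|] /=; rewrite ?mulr1 ?mul1r ?mulr0 ?mul0r ?subr0 ?sub0r ?eqxx//.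
- by rewrite subr_eq0.
- by rewrite oppr_eq0 oner_eq0.
- by rewrite oner_eq0.
Qed.

Lemma root_listP p rs z : root_list p rs -> inV p z <-> z \in rs.
Proof.
move=> [srs [c c0 e]]; rewrite /inV.
have -> : beval p z = c * \prod_(w <- rs)
    ((cp1rep w).2 * (cp1rep z).1 - (cp1rep w).1 * (cp1rep z).2).
  rewrite -(hev_root rs) -coefZ -hevZ -e srs /hev coef_sum; apply: eq_bigr => k _.
  by rewrite coefZ coef_bpoly -!rmorphXn -rmorphM/= coefC/= mulrA.
split=> [/eqP|zrs].
  rewrite mulf_eq0 (negbTE c0)/= prodf_seq_eq0 => /hasP[w wrs /=].
  by rewrite det_rep_eq0 => /eqP ->.
apply/eqP; rewrite mulf_eq0 prodf_seq_eq0; apply/orP; right.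
by apply/hasP; exists z; rewrite //= det_rep_eq0.
Qed.

Lemma prod_linf_split z rs (k := count_mem z rs) : \prod_(w <- rs) linf w =
  linf z ^+ k * \prod_(w <- [seq w <- rs | w != z]) linf w.
Proof.
rewrite (bigID (pred1 z))/= big_filter; congr (_ * _).
rewrite -big_filter (_ : [seq w <- rs | w == z] = nseq k z) ?big_nseq ?iter_mulr_1//.
rewrite /k -size_filter.
have : all (pred1 z) [seq w <- rs | w == z] by exact: filter_all.
by move/all_pred1P.
Qed.

Lemma size_prod_linf (s : seq (cp1 R)) : (size (\prod_(w <- s) linf w)%R <= (size s).+1)%N.
Proof.
have := @size_prod_lin R _ s (fun w => (cp1rep w).2) (fun w => (cp1rep w).1) 1 1%N.
by rewrite size_poly1 mulr1 addn1; apply.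
Qed.

(** If [m] exceeded the count [k], cancelling [linf z ^+ k] and evaluating at [z] would give zero on
    one side only. The evaluation is homogeneous, and the bound on [size q] is what makes it work at
    infinity, where [linf z] is a unit of the polynomial ring. *)
Lemma formdvdP p rs z m : root_list p rs -> (m <= d)%N ->
  formdvd p z m <-> (m <= count_mem z rs)%N.
Proof.
move=> [srs [c c0 e]] md; rewrite /formdvd e (prod_linf_split z rs).
set k := count_mem z rs; set s := [seq w <- rs | w != z].
have ks : (k + size s = d)%N.
  by rewrite -srs /k size_filter -(count_predC (pred1 z) rs).
have zs : all (predC1 z) s by exact: filter_all.
split=> [[q [sq eq]]|mk]; last first.
  exists (c *: \prod_(w <- nseq (k - m) z ++ s) linf w); split.
    apply: (leq_trans (size_scale_leq _ _)); apply: (leq_trans (size_prod_linf _)).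
    by rewrite size_cat size_nseq addn1 ltnS -ks addnBAC.
  rewrite big_cat/= big_nseq iter_mulr_1 -scalerAr; congr (_ *: _).
  by rewrite mulrA -exprD subnKC.
rewrite leqNgt; apply/negP => km.
have {}eq : c *: \prod_(w <- s) linf w = linf z ^+ (m - k) * q.
  apply: (@mulfI _ (linf z ^+ k)); first by rewrite expf_neq0// linf_neq0.
  by rewrite -scalerAr eq mulrA -exprD subnKC// ltnW.
have := congr1 (fun P => (hev (size s) P (cp1rep z).1%:P (cp1rep z).2%:P)`_0) eq.
rewrite hevZ coefZ hev_root => /eqP.
have -> : linf z ^+ (m - k) = \prod_(w <- nseq (m - k) z) linf w.
  by rewrite big_nseq iter_mulr_1.
have -> : size s = (size (nseq (m - k) z) + (d - m))%N.
  by rewrite size_nseq; move: ks km md; clearbody k s; lia.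
rewrite (@hev_prod_lin R _ _ (fun w => (cp1rep w).2) (fun w => (cp1rep w).1)); last by rewrite -addn1.
rewrite coef0M big_nseq iter_mulr_1.
have -> : ((cp1rep z).2 *: (cp1rep z).1%:P - (cp1rep z).1 *: (cp1rep z).2%:P : {poly C}) = 0.
  by rewrite -!mul_polyC -!rmorphM/= mulrC subrr.
rewrite expr0n subn_eq0 leqNgt km/= coef0 mul0r mulf_eq0 (negbTE c0)/= prodf_seq_eq0.
by move=> /hasP[w ws /=]; rewrite det_rep_eq0 eq_sym; move/allP: zs => /(_ w ws) /= /negbTE ->.
Qed.

Lemma mult_count p rs z : root_list p rs -> mult p z = count_mem z rs.
Proof.
move=> prs; have cd : (count_mem z rs <= d)%N.
  by rewrite -prs.1; exact: count_size.
apply/eqP; rewrite eqn_leq; apply/andP; split.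
  apply/bigmax_leqP => m /asboolP; apply: (formdvdP _ prs _).1.
  by rewrite -ltnS.
rewrite -[leqLHS](@inordK d)//.
apply: (@leq_bigmax_cond _ (fun m : 'I_d.+1 => `[< formdvd p z m >]) (fun m : 'I_d.+1 => m : nat)).
by apply/asboolP; apply/(formdvdP _ prs); rewrite inordK.
Qed.
End Roots.

(** * Bombieri-Weyl distance to the discriminant *)

Section BombieriWeyl.
Variable R : realType.
Local Notation C := R[i].
Variable d : nat.
Implicit Types (p q : bform R d).

Lemma ReD (x y : C) : complex.Re (x + y) = complex.Re x + complex.Re y.
Proof. by case: x y => [? ?] [? ?]. Qed.

Lemma ImD (x y : C) : complex.Im (x + y) = complex.Im x + complex.Im y.
Proof. by case: x y => [? ?] [? ?]. Qed.

Lemma Re_sum (I : Type) (s : seq I) (F : I -> C) :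
  complex.Re (\sum_(i <- s) F i) = \sum_(i <- s) complex.Re (F i).
Proof. by elim/big_ind2: _ => // x a y b <- <-; rewrite ReD. Qed.

Lemma Im_sum (I : Type) (s : seq I) (F : I -> C) :
  complex.Im (\sum_(i <- s) F i) = \sum_(i <- s) complex.Im (F i).
Proof. by elim/big_ind2: _ => // x a y b <- <-; rewrite ImD. Qed.

Lemma div_natC (x : C) n :
  x / n%:R = (complex.Re x / n%:R +i* (complex.Im x / n%:R))%C.
Proof.
have -> : (n%:R : C) = ((n%:R : R)%:C)%C by rewrite rmorph_nat.
by rewrite -fmorphV; case: x => a b; simpc.
Qed.

Lemma bwnorm_sqr p : bwnorm p ^+ 2 = \sum_(k < d.+1) cabs (p k) ^+ 2 / 'C(d, k)%:R.
Proof.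
have e : complex.Re (bw p p) = \sum_(k < d.+1) cabs (p k) ^+ 2 / 'C(d, k)%:R.
  rewrite /bw Re_sum; apply: eq_bigr => k _; rewrite div_natC/= cabs_sqr.
  by congr (_ / _); case: (p k) => a b /=; ring.
by rewrite /bwnorm e sqr_sqrtr// sumr_ge0// => k _; rewrite divr_ge0 ?sqr_ge0.
Qed.

Lemma bwnorm_ge0 p : 0 <= bwnorm p.
Proof. exact: sqrtr_ge0. Qed.

Lemma bin_gt0R (k : 'I_d.+1) : 0 < ('C(d, k)%:R : R).
Proof. by rewrite ltr0n bin_gt0 -ltnS. Qed.

Lemma coef_le_bwnorm p : coef_le (bpoly p) (2 ^+ d * bwnorm p).
Proof.
move=> k; have [kd|kd] := ltnP k d.+1; last first.
  rewrite nth_default ?(leq_trans (size_bpoly _))// cabs0.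
  by rewrite mulr_ge0 ?bwnorm_ge0// exprn_ge0.
rewrite -[k in _`_k]/(nat_of_ord (Ordinal kd)) coef_bpoly; set i := Ordinal kd.
rewrite -(@ler_pXn2r _ 2)// ?nnegrE ?cabs_ge0 ?mulr_ge0 ?bwnorm_ge0 ?exprn_ge0//.
have b1 : ('C(d, i)%:R : R) <= 2 ^+ d.
  rewrite -natrX ler_nat; have := Pascal 1 1 d; rewrite addn1.
  rewrite (eq_bigr (fun i : 'I_d.+1 => 'C(d, i))) => [->|j _]; last by rewrite !exp1n !muln1.
  by rewrite (bigD1 i)//= leq_addr.
have h : cabs (p i) ^+ 2 <= 'C(d, i)%:R * bwnorm p ^+ 2.
  rewrite mulrC -ler_pdivrMr ?bin_gt0R// bwnorm_sqr (bigD1 i)//= lerDl.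
  by apply: sumr_ge0 => j _; rewrite divr_ge0 ?sqr_ge0.
apply: (le_trans h); rewrite exprMn ler_wpM2r ?sqr_ge0//.
by apply: (le_trans b1); rewrite -exprM ler_eXn2l ?leq_pmulr//; lra.
Qed.

Lemma bwnorm_coef_le p (M : R) : coef_le (bpoly p) M -> bwnorm p <= d.+1%:R * M.
Proof.
move=> hM; have M0 : 0 <= M := le_trans (cabs_ge0 _) (hM 0%N).
rewrite -(@ler_pXn2r _ 2)// ?nnegrE ?mulr_ge0 ?bwnorm_ge0// bwnorm_sqr.
apply: (@le_trans _ _ (d.+1%:R * M ^+ 2)); last first.
  by rewrite exprMn ler_wpM2r ?sqr_ge0// expr2 ler_peMl// ler1n.
rewrite -[d.+1 in leRHS]card_ord mulr_natl -sumr_const; apply: ler_sum => k _.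
rewrite ler_pdivrMr ?bin_gt0R//; apply: (@le_trans _ _ (M ^+ 2)).
  by rewrite ler_pXn2r// ?nnegrE ?cabs_ge0// -coef_bpoly.
by rewrite ler_peMr ?sqr_ge0// ler1n bin_gt0 -ltnS.
Qed.

Lemma bwnorm_gt0 p : p != (fun _ => 0) -> 0 < bwnorm p.
Proof.
move=> p0; rewrite lt_neqAle bwnorm_ge0 andbT; apply/eqP => e.
move/eqP: p0; apply; apply: bpoly_inj; apply/polyP => k.
have := coef_le_bwnorm p k; rewrite -e mulr0 => h.
have -> : (bpoly p)`_k = 0 by apply: cabs_eq0; apply/eqP; rewrite eq_le h cabs_ge0.
by rewrite coef_poly; case: ifP.
Qed.

Lemma bwnorm_sub p q (l : C) : bwnorm (fun k => p k - l * q k) ^+ 2 =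
  bwnorm p ^+ 2 - 2 * (complex.Re l * complex.Re (bw p q) + complex.Im l * complex.Im (bw p q))
   + cabs l ^+ 2 * bwnorm q ^+ 2.
Proof.
rewrite !bwnorm_sqr /bw Re_sum Im_sum !mulr_sumr -big_split mulr_sumr -sumrB -big_split.
apply: eq_bigr => k _ /=; rewrite div_natC/= !cabs_sqr.
by case: l (p k) (q k) => [l1 l2] [a b] [e f] /=; ring.
Qed.

(** Completing the square in [l]. The last term vanishes when [l q] is the orthogonal projection of
    [p] onto the line of [q]. *)
Lemma bw_gap p q (l : C) : bwnorm q ^+ 2 * bwnorm (fun k => p k - l * q k) ^+ 2 =
  bwnorm p ^+ 2 * bwnorm q ^+ 2 - cabs (bw p q) ^+ 2
  + cabs (bw p q - l * ((bwnorm q ^+ 2)%:C)%C) ^+ 2.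
Proof.
rewrite bwnorm_sub !cabs_sqr.
by case: l (bw p q) => [l1 l2] [a b] /=; ring.
Qed.

Lemma bw_gap0 p q : q != (fun _ => 0) -> exists l,
  bwnorm q ^+ 2 * bwnorm (fun k => p k - l * q k) ^+ 2 =
  bwnorm p ^+ 2 * bwnorm q ^+ 2 - cabs (bw p q) ^+ 2.
Proof.
move=> /bwnorm_gt0 q0; exists (bw p q / ((bwnorm q ^+ 2)%:C)%C).
rewrite bw_gap divfK ?subrr ?cabs0 ?expr0n/= ?addr0//.
by apply/eqP => /complexI/eqP; rewrite expf_eq0/= gt_eqF.
Qed.

Lemma dBW_arg p q : p != (fun _ => 0) -> q != (fun _ => 0) ->
  0 <= cabs (bw p q) / (bwnorm p * bwnorm q) <= 1.
Proof.
move=> p0 q0; have [l e] := bw_gap0 p q0.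
have pq0 : 0 < bwnorm p * bwnorm q by rewrite mulr_gt0 ?bwnorm_gt0.
rewrite divr_ge0 ?cabs_ge0 ?(ltW pq0)//= ler_pdivrMr// mul1r.
rewrite -(@ler_pXn2r _ 2)// ?nnegrE ?cabs_ge0 ?(ltW pq0)//.
by rewrite exprMn -subr_ge0 -e mulr_ge0 ?sqr_ge0.
Qed.

Lemma dBW_range p q : p != (fun _ => 0) -> q != (fun _ => 0) -> 0 <= dBW p q <= pi / 2.
Proof.
move=> p0 q0; have /andP[h0 h1] := dBW_arg p0 q0.
have pp := @pi_gt0 R.
have d0 : 0 <= dBW p q by apply: acos_ge0; lra.
rewrite d0/=.
have dpi : dBW p q <= pi by apply: acos_lepi; lra.
rewrite leNgt -ltr_cos ?in_itv/= ?d0//; last by apply/andP; split; lra.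
by rewrite cos_pihalf acosK -?leNgt// in_itv/=; lra.
Qed.

Lemma sin_dBW p q : p != (fun _ => 0) -> q != (fun _ => 0) ->
  (sin (dBW p q) * bwnorm p) ^+ 2 * bwnorm q ^+ 2 =
  bwnorm p ^+ 2 * bwnorm q ^+ 2 - cabs (bw p q) ^+ 2.
Proof.
move=> p0 q0; have /andP[h0 h1] := dBW_arg p0 q0.
rewrite exprMn sin2cos2 acosK; last by rewrite in_itv/=; lra.
have pN : bwnorm p != 0 by rewrite gt_eqF ?bwnorm_gt0.
have qN : bwnorm q != 0 by rewrite gt_eqF ?bwnorm_gt0.
by field; rewrite pN qN.
Qed.

Lemma sin_le (x : R) : 0 <= x -> sin x <= x.
Proof.
move=> x0; have [c _] := @MVT_segment R sin cos 0 x x0 (fun x _ => is_derive_sin x)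
  (@continuous_subspaceT _ _ (`[0, x]) _ (@continuous_sin R)).
rewrite sin0 !subr0 => ->; rewrite ler_piMl//; exact: cos_le1.
Qed.

(** The best [l] attains [sin (dBW p q) * bwnorm p]. Together with [dBW_upper], where
    [x <= pi / 2 * sin x] is used, this reduces projective distances to norms of differences
    [p - l q]. *)
Lemma dBW_lower p q : p != (fun _ => 0) -> q != (fun _ => 0) ->
  exists l, bwnorm (fun k => p k - l * q k) <= dBW p q * bwnorm p.
Proof.
move=> p0 q0; have [l] := bw_gap0 p q0; rewrite -sin_dBW// mulrC => /mulIf e.
exists l; have /andP[d0 d1] := dBW_range p0 q0.
have s0 : 0 <= sin (dBW p q) by apply: sin_ge0_pi; have := @pi_gt0 R; lra.
have {}e : bwnorm (fun k => p k - l * q k) = sin (dBW p q) * bwnorm p.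
  apply/eqP; rewrite -(@eqrXn2 _ 2)// ?mulr_ge0 ?bwnorm_ge0// e//.
  by rewrite expf_eq0/= gt_eqF ?bwnorm_gt0.
by rewrite e ler_wpM2r ?bwnorm_ge0// sin_le.
Qed.

Lemma dBW_upper p q l : p != (fun _ => 0) -> q != (fun _ => 0) ->
  dBW p q * bwnorm p <= pi / 2 * bwnorm (fun k => p k - l * q k).
Proof.
move=> p0 q0; have /andP[d0 d1] := dBW_range p0 q0.
have pp := @pi_gt0 R.
have s0 : 0 <= sin (dBW p q) by apply: sin_ge0_pi; lra.
have h : sin (dBW p q) * bwnorm p <= bwnorm (fun k => p k - l * q k).
  rewrite -(@ler_pXn2r _ 2)// ?nnegrE ?mulr_ge0 ?bwnorm_ge0//.
  have qp : 0 < bwnorm q ^+ 2 by rewrite exprn_gt0 ?bwnorm_gt0.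
  rewrite -(ler_pM2r qp) sin_dBW// [leRHS]mulrC bw_gap lerDl sqr_ge0//.
have := @sin_chord R (dBW p q) (pi / 2) d0 d1; rewrite sin_pihalf mulr1 => h2.
apply: (@le_trans _ _ (pi / 2 * sin (dBW p q) * bwnorm p)).
  by rewrite ler_wpM2r ?bwnorm_ge0// h2; lra.
by rewrite -mulrA ler_wpM2l//; lra.
Qed.
End BombieriWeyl.

Section UnitForms.
Variable R : realType.
Local Notation C := R[i].
Implicit Types (z w : cp1 R).

(** Unit representatives: their determinants are sines of distances ([det_unit]), and the
    coefficient estimates hold with constants that do not depend on the roots. *)
Definition ua z : C := (cp1rep z).1 / ((nrm2 (cp1rep z))%:C)%C.
Definition ub z : C := (cp1rep z).2 / ((nrm2 (cp1rep z))%:C)%C.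
Definition ulin z : {poly C} := lin (ub z) (ua z).

Lemma nrmC_neq0 z : ((nrm2 (cp1rep z))%:C)%C != 0 :> C.
Proof. by apply/eqP => /complexI/eqP; rewrite gt_eqF ?nrm2_rep_gt0. Qed.

Lemma unit_rep z : cabs (ua z) ^+ 2 + cabs (ub z) ^+ 2 = 1.
Proof.
rewrite /ua /ub !cabsM !cabsV !cabs_real ?(ltW (nrm2_rep_gt0 z))// !exprMn -mulrDl.
by rewrite -nrm2_sqr exprVn mulfV// expf_neq0// gt_eqF ?nrm2_rep_gt0.
Qed.

Lemma cabs_ua_le1 z : cabs (ua z) <= 1.
Proof. by have := unit_rep z; have := cabs_ge0 (ua z); have := cabs_ge0 (ub z); nra. Qed.

Lemma cabs_ub_le1 z : cabs (ub z) <= 1.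
Proof. by have := unit_rep z; have := cabs_ge0 (ua z); have := cabs_ge0 (ub z); nra. Qed.

Lemma linf_ulin z : linf z = ((nrm2 (cp1rep z))%:C)%C *: ulin z.
Proof.
rewrite /ulin /lin scalerBr scalerA -mul_polyC -[in X in _ - X]mul_polyC -!rmorphM/=.
by rewrite mul_polyC /ua /ub !(mulrC _ (_ / _)) !divfK ?nrmC_neq0.
Qed.

Lemma det_unit z w : cabs (ub w * ua z - ua w * ub z) = sin (fs_dist z w).
Proof.
rewrite fs_sin /det2 /ua /ub.
rewrite -[X in _ / (X * _)](cabs_real (ltW (nrm2_rep_gt0 z))).
rewrite -[X in _ / (_ * X)](cabs_real (ltW (nrm2_rep_gt0 w))).
rewrite -cabsM -cabsV -cabsM; congr (cabs _).
by field; rewrite !nrmC_neq0.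
Qed.

Lemma conj_cabs (x : C) : x * conjc x = ((cabs x ^+ 2)%:C)%C.
Proof. by rewrite cabs_sqr; case: x => a b; simpc; congr (_ +i* _)%C; ring. Qed.

Lemma unit_repC z : ua z * conjc (ua z) + ub z * conjc (ub z) = 1.
Proof. by rewrite !conj_cabs -rmorphD/= unit_rep. Qed.

Lemma prod_ulin (s : seq (cp1 R)) (c : C) : c != 0 -> exists2 k : C, k != 0 &
  c *: \prod_(w <- s) linf w = k *: \prod_(w <- s) ulin w.
Proof.
elim: s c => [|w s IH] c c0; first by exists c; rewrite ?big_nil.
have [|k k0 e] := IH (c * ((nrm2 (cp1rep w))%:C)%C); first by rewrite mulf_neq0// nrmC_neq0.
exists k => //; rewrite !big_cons linf_ulin -scalerAl scalerA.
by rewrite [in LHS]scalerAr e -scalerAr.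
Qed.
End UnitForms.

Section DistanceBounds.
Variable R : realType.
Local Notation C := R[i].
Variable d : nat.
Implicit Types (p q : bform R d) (z w : cp1 R) (rs : seq (cp1 R)).

Lemma root_list_perm p rs rs' : perm_eq rs rs' -> root_list p rs -> root_list p rs'.
Proof.
move=> pr [s [c c0 e]]; split; first by rewrite -(perm_size pr).
by exists c => //; rewrite e (perm_big _ pr).
Qed.

Lemma root_list_nz p rs : root_list p rs -> p != (fun _ => 0).
Proof.
move=> [_ [c c0 e]]; apply/eqP => p0; move/eqP: e; rewrite p0.
have -> : bpoly (fun _ : 'I_d.+1 => 0 : C) = 0.
  by apply/polyP => k; rewrite coef_poly coef0; case: ifP.
rewrite eq_sym scaler_eq0 (negbTE c0)/= prodf_seq_eq0 => /hasP[w _ /=].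
by rewrite (negbTE (linf_neq0 w)).
Qed.

(* Replace the root [w] of [p] by a second copy of [z]. *)
Lemma dBW_Delta_at_le : exists2 K : R, 0 < K & forall p rs z w, root_list p rs ->
  z \in rs -> w \in rs -> z != w ->
  exists2 q, Delta_at z q & dBW p q <= K * fs_dist z w.
Proof.
(* The factors come, in order, from [dBW_upper], [bwnorm_coef_le], [coef_le_lin], the division of
   [p] by the form of [w], and [coef_le_bwnorm]. *)
pose K : R := pi / 2 * (d.+1%:R * (2 * (4 ^+ d * 2 ^+ d))).
have pp := @pi_gt0 R.
have K0 : 0 < K by rewrite /K !mulr_gt0 ?exprn_gt0//; lra.
exists K => // p rs z w prs zrs wrs zw.
have p0 := root_list_nz prs.
have pr : perm_eq rs (w :: z :: rem z (rem w rs)).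
  apply: (perm_trans (perm_to_rem wrs)); rewrite perm_cons; apply: perm_to_rem.
  have := perm_mem (perm_to_rem wrs) z; rewrite zrs inE (negbTE zw)/= => <-//.
set s := rem z (rem w rs) in pr.
have [srs [c c0 e]] := root_list_perm pr prs.
pose H := linf z * \prod_(x <- s) linf x.
have sH : (size H <= d)%N.
  have := size_prod_linf (z :: s); rewrite big_cons -srs/=; exact.
have sq : (size (c *: (linf z * H)) <= d.+1)%N.
  by apply: (leq_trans (size_scale_leq _ _)); rewrite linfE; exact: size_lin_mul.
pose q : bform R d := fun k => (c *: (linf z * H))`_k.
have qE : bpoly q = c *: (linf z * H) by exact: bpoly_coef.
have qrs : root_list q (z :: z :: s).
  by split => //; exists c => //; rewrite qE !big_cons.
have q0 := root_list_nz qrs.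
exists q.
  by split=> //; rewrite (mult_count _ qrs)/= eqxx.
pose nw : C := ((nrm2 (cp1rep w))%:C)%C; pose nz : C := ((nrm2 (cp1rep z))%:C)%C.
have nz0 : nz != 0 by exact: nrmC_neq0.
have nw0 : nw != 0 by exact: nrmC_neq0.
pose h := (c * nw) *: H.
have pE : bpoly p = ulin w * h.
  by rewrite e !big_cons -/H linf_ulin -/nw /h -scalerAl scalerA scalerAr.
have qE2 : bpoly q = (nz / nw) *: (ulin z * h).
  rewrite qE linf_ulin -/nz /h -scalerAl -scalerAr !scalerA; congr (_ *: _).
  by clearbody nw nz; field.
(* [m] is the Hermitian product of the unit vectors of [w] and [z], so the vector of [w] minus [m]
   times that of [z] is orthogonal to [z] and has length [sin (fs_dist z w)]. The scalar [l] is [m]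
   freed from the normalizations. *)
pose m : C := ub w * conjc (ub z) + ua w * conjc (ua z).
pose l : C := m / (nz / nw).
have lE : bpoly (fun k => p k - l * q k) =
    lin (ub w - m * ub z) (ua w - m * ua z) * h.
  have -> : bpoly (fun k => p k - l * q k) = bpoly p - l *: bpoly q.
    by apply/polyP => k; rewrite coefB coefZ !coef_poly; case: ifP; rewrite ?mulr0 ?subr0.
  rewrite pE qE2 scalerA divfK ?mulf_neq0 ?invr_neq0// scalerAl -mulrBl; congr (_ * _).
  rewrite /ulin /lin scalerBr scalerA -!mul_polyC !polyCB !polyCM; ring.
have uz := unit_repC z.
have h1 : cabs (ub w - m * ub z) <= sin (fs_dist z w).
  have -> : ub w - m * ub z = conjc (ua z) * (ub w * ua z - ua w * ub z).
    by rewrite -[X in X - _]mulr1 -uz /m; ring.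
  by rewrite cabsM det_unit cabs_conj ler_piMl ?fs_sin_ge0 ?cabs_ua_le1.
have h2 : cabs (ua w - m * ua z) <= sin (fs_dist z w).
  have -> : ua w - m * ua z = - (conjc (ub z) * (ub w * ua z - ua w * ub z)).
    by rewrite -[X in X - _]mulr1 -uz /m; ring.
  by rewrite cabsN cabsM det_unit cabs_conj ler_piMl ?fs_sin_ge0 ?cabs_ub_le1.
have hh : coef_le h (4 ^+ d * (2 ^+ d * bwnorm p)).
  apply: (@coef_le_lin_inv R (ub w) (ua w)); first exact: unit_rep.
    exact: leq_trans (size_scale_leq _ _) sH.
  by rewrite -/(ulin w) -pE; exact: coef_le_bwnorm.
have := coef_le_lin (fs_sin_ge0 z w) h2 h1 hh.
rewrite -lE => /bwnorm_coef_le hn.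
have := dBW_upper l p0 q0.
have pn : 0 < bwnorm p by exact: bwnorm_gt0.
move=> hu; rewrite -(ler_pM2r pn); apply: (le_trans hu).
have hs : sin (fs_dist z w) <= fs_dist z w by rewrite sin_le ?fs_ge0.
apply: (@le_trans _ _ (pi / 2 * (d.+1%:R * (2 * sin (fs_dist z w) * (4 ^+ d * (2 ^+ d * bwnorm p)))))).
  by rewrite ler_wpM2l//; lra.
have -> : pi / 2 * (d.+1%:R * (2 * sin (fs_dist z w) * (4 ^+ d * (2 ^+ d * bwnorm p)))) =
  K * sin (fs_dist z w) * bwnorm p by rewrite /K; ring.
by rewrite ler_wpM2r ?(ltW pn)// ler_wpM2l// ltW.
Qed.
End DistanceBounds.

Section LowerBound.
Variable R : realType.
Local Notation C := R[i].
Variable d : nat.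
Implicit Types (p q : bform R d) (z w : cp1 R) (rs : seq (cp1 R)).

Lemma lin0 (b a : C) : (lin b a)`_0 = - a.
Proof. by rewrite /lin coefB coefZ coefX coefC/= mulr0 sub0r. Qed.

Lemma lin1 (b a : C) : (lin b a)`_1 = b.
Proof. by rewrite /lin coefB coefZ coefX coefC/= mulr1 subr0. Qed.

Lemma hev_prod_ulin (s : seq (cp1 R)) (U V : {poly C}) :
  hev (size s) (\prod_(w <- s) ulin w) U V = \prod_(w <- s) (ub w *: U - ua w *: V).
Proof.
have := @hev_prod_lin R _ s (@ub R) (@ua R) 1 0 U V; rewrite size_poly1 addn0 mulr1 hev0 mulr1.
exact.
Qed.

Lemma prod_ulin_coef_le (s : seq (cp1 R)) : coef_le (\prod_(w <- s) ulin w) (2 ^+ size s).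
Proof.
have := @coef_le_prod_lin R _ s (@ub R) (@ua R) 1 1 (@cabs_ua_le1 R) (@cabs_ub_le1 R) (coef_le1 R).
by rewrite !mulr1.
Qed.

Lemma bpoly_ulin p rs : root_list p rs ->
  exists2 k : C, k != 0 & bpoly p = k *: \prod_(w <- rs) ulin w.
Proof. by move=> [_ [c c0 ->]]; exact: prod_ulin. Qed.

(* Expand [p] and [q] at [z + s v] with [v] orthogonal to [z]: the coefficients
   of [1] and [s] vanish for [q], and for [p] they cannot both be small. *)
Lemma dBW_Delta_at_ge : exists2 K : R, 0 < K & forall p rs z w0 q, root_list p rs ->
  w0 \in rs -> Delta_at z q ->
  (\prod_(w <- rem w0 rs) sin (fs_dist z w)) ^+ 2 <= K * dBW p q.
Proof.
pose K2 : R := d.+1%:R * (2 ^+ d * 2 ^+ d).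
pose K1 : R := d.+1%:R * (2 ^+ d * 2 ^+ d).
pose K : R := (2 + K1) * K2 * (d.+1%:R * 2 ^+ d).
have K20 : 0 < K2 by rewrite /K2 !mulr_gt0 ?exprn_gt0.
have K10 : 0 < K1 by rewrite /K1 !mulr_gt0 ?exprn_gt0.
have K0 : 0 < K by rewrite /K !mulr_gt0 ?exprn_gt0//; lra.
exists K => // p rs z w0 q prs w0rs [q0 mq].
have p0 := root_list_nz prs.
(* The factor of [w0] is set apart: [w0] may be close or equal to [z], so its value at [z] can be
   small, but not together with its slope. *)
set s := rem w0 rs.
have prs' := root_list_perm (perm_to_rem w0rs) prs; rewrite -/s in prs'.
have ds : d = (size s).+1 by exact: esym prs'.1.
have [k k0 pE] := bpoly_ulin prs'.
have [rq qrs] := root_list_exists q0.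
have [s' qrs'] : exists s', root_list q (z :: z :: s').
  rewrite (mult_count _ qrs) in mq.
  have zq : z \in rq by rewrite -has_pred1 has_count (ltn_trans _ mq).
  have pr1 := perm_to_rem zq.
  have zq' : z \in rem z rq.
    move/permP/(_ (pred1 z)): pr1 mq => ->; rewrite /= eqxx add1n ltnS.
    by rewrite -has_count has_pred1.
  exists (rem z (rem z rq)); apply: root_list_perm qrs.
  by apply: (perm_trans pr1); rewrite perm_cons; exact: perm_to_rem.
have [k' k'0 qE] := bpoly_ulin qrs'.
have [l lE] := dBW_lower p0 q0.
pose E : bform R d := fun i => p i - l * q i.
have EE : bpoly E = bpoly p - l *: bpoly q.
  by apply/polyP => i; rewrite coefB coefZ !coef_poly; case: ifP; rewrite ?mulr0 ?subr0.
(* [(u', v')] is the unit vector orthogonal to [z]. Since [lin u' (- ua z)] is [ua z + u' X], the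
   indeterminate is the parameter [s] of the expansion. *)
pose u' := - conjc (ub z); pose v' := conjc (ua z).
pose U := lin u' (- ua z); pose V := lin v' (- ub z).
pose f w := ub w *: U - ua w *: V.
have f0 w : (f w)`_0 = ub w * ua z - ua w * ub z.
  by rewrite /f coefB !coefZ !lin0 !opprK.
have f1 w : (f w)`_1 = - (ub w * conjc (ub z) + ua w * conjc (ua z)).
  by rewrite /f coefB !coefZ !lin1 /u' /v'; ring.
have hq : hev d (bpoly q) U V = k' *: (f z * (f z * \prod_(w <- s') f w)).
  have ds' : d = size (z :: z :: s') by exact: esym qrs'.1.
  by rewrite qE hevZ [in LHS]ds' hev_prod_ulin !big_cons.
have fz0 : (f z)`_0 = 0 by rewrite f0 mulrC subrr.
have hq0 : (hev d (bpoly q) U V)`_0 = 0 by rewrite hq coefZ coef0M fz0 mul0r mulr0.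
have coef1M (A B : {poly C}) : (A * B)`_1 = A`_0 * B`_1 + A`_1 * B`_0.
  by rewrite coefM big_ord_recr big_ord1.
have hq1 : (hev d (bpoly q) U V)`_1 = 0.
  by rewrite hq coefZ coef1M coef0M fz0 !mul0r mulr0 addr0 mulr0.
set g := \prod_(w <- s) f w.
have hp : hev d (bpoly p) U V = k *: (f w0 * g).
  by rewrite pE hevZ [in LHS]ds (hev_prod_ulin (w0 :: s)) big_cons.
have hU : cabs (- ua z) <= 1 by rewrite cabsN cabs_ua_le1.
have hV : cabs (- ub z) <= 1 by rewrite cabsN cabs_ub_le1.
have hu : cabs u' <= 1 by rewrite cabsN cabs_conj cabs_ub_le1.
have hv : cabs v' <= 1 by rewrite cabs_conj cabs_ua_le1.
have hE := coef_le_hev d hU hu hV hv (coef_le_bwnorm E).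
rewrite -/U -/V in hE.
have hEE : hev d (bpoly E) U V = hev d (bpoly p) U V - l *: hev d (bpoly q) U V.
  by rewrite EE hevD hevN hevZ.
set e := bwnorm E in hE.
have e0 : 0 <= e by exact: bwnorm_ge0.
have K2e : d.+1%:R * (2 ^+ d * (2 ^+ d * e)) = K2 * e by rewrite /K2; ring.
rewrite K2e hEE in hE.
have A0 := hE 0%N; have A1 := hE 1%N.
rewrite coefB coefZ hq0 mulr0 subr0 hp coefZ coef0M !cabsM in A0.
rewrite coefB coefZ hq1 mulr0 subr0 hp coefZ coef1M cabsM in A1.
have g0 : cabs g`_0 = \prod_(w <- s) sin (fs_dist z w).
  rewrite /g (_ : (\prod_(w <- s) f w)`_0 = \prod_(w <- s) (f w)`_0).
    by rewrite cabs_prod; apply: eq_bigr => w _; rewrite f0 det_unit.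
  elim: (s) => [|w s1 IH]; first by rewrite !big_nil coefC.
  by rewrite !big_cons coef0M IH.
rewrite -g0.
have gle1 : cabs g`_0 <= 1.
  rewrite g0; elim: (s) => [|w s1 IH]; first by rewrite big_nil.
  rewrite big_cons mulr_ile1 ?fs_sin_ge0 ?sin_le1//.
  by rewrite prodr_ge0// => i _; exact: fs_sin_ge0.
have g1 : cabs g`_1 <= K1.
  have := coef_le_hev (size s) hU hu hV hv (prod_ulin_coef_le s) 1%N.
  rewrite -/U -/V hev_prod_ulin -/g => /le_trans; apply.
  have ss : (size s <= d)%N by rewrite [leqRHS]ds.
  rewrite /K1 ler_pM ?mulr_ge0 ?exprn_ge0 ?ler_nat ?ltnS// ler_pM ?exprn_ge0//;
    by rewrite ler_eXn2l//; lra.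
(* Value and slope of the form of [w0] along the chosen line are, in modulus, the sine and the
   cosine of [fs_dist z w0]. *)
have de1 : cabs (f w0)`_0 ^+ 2 + cabs (f w0)`_1 ^+ 2 = 1.
  rewrite f0 f1 cabsN det_unit.
  have -> : cabs (ub w0 * conjc (ub z) + ua w0 * conjc (ua z)) = cos (fs_dist z w0).
    rewrite fs_sym fs_cos /herm2 /ua /ub.
    rewrite -[X in _ / (X * _)](cabs_real (ltW (nrm2_rep_gt0 w0))).
    rewrite -[X in _ / (_ * X)](cabs_real (ltW (nrm2_rep_gt0 z))).
    rewrite -cabsM -cabsV -cabsM; congr (cabs _).
    have cj (x : C) (r : R) : conjc (x / (r%:C)%C) = conjc x / (r%:C)%C.
      by rewrite -fmorphV; case: x => ? ?; simpc.
    rewrite !cj; by field; rewrite !nrmC_neq0.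
  by rewrite addrC cos2Dsin2.
set D := cabs (f w0)`_0 in A0 de1; set Ep := cabs (f w0)`_1 in de1.
set G := cabs g`_0 in A0 gle1 *.
have D0 : 0 <= D by exact: cabs_ge0.
have Ep0 : 0 <= Ep by exact: cabs_ge0.
have G0 : 0 <= G by exact: cabs_ge0.
set kk := cabs k in A0 A1.
have kk0 : 0 < kk by exact: cabs_gt0.
have A2 : kk * (Ep * G) <= K2 * e + kk * D * K1.
  have -> : Ep * G = cabs (((f w0)`_0 * g`_1 + (f w0)`_1 * g`_0) - (f w0)`_0 * g`_1).
    by rewrite addrAC subrr add0r cabsM.
  apply: (@le_trans _ _ (kk * (cabs ((f w0)`_0 * g`_1 + (f w0)`_1 * g`_0) + D * cabs g`_1))).
    by rewrite ler_wpM2l ?(ltW kk0)// -cabsM cabsB.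
  rewrite mulrDr lerD// -mulrA ler_wpM2l ?(ltW kk0)// ler_wpM2l//.
have K2e0 : 0 <= K2 * e by rewrite mulr_ge0// ltW.
have B1 : kk * G ^+ 2 * D <= K2 * e.
  have -> : kk * G ^+ 2 * D = G * (kk * (D * G)) by ring.
  by apply: (@le_trans _ _ (G * (K2 * e))); [rewrite ler_wpM2l|rewrite ler_piMl].
(* The term [kk * D * K1] in [A2] is controlled only after one more multiplication by [G], through
   [A0]. This is the origin of the square in the statement. *)
have B2 : kk * G ^+ 2 * Ep <= K2 * e + K1 * (K2 * e).
  have -> : kk * G ^+ 2 * Ep = G * (kk * (Ep * G)) by ring.
  apply: (@le_trans _ _ (G * (K2 * e + kk * D * K1))); first by rewrite ler_wpM2l.
  rewrite mulrDr lerD//; first by rewrite ler_piMl.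
  have -> : G * (kk * D * K1) = K1 * (kk * (D * G)) by ring.
  by rewrite ler_wpM2l// ltW.
have B3 : 1 <= D + Ep by nra.
have B4 : kk * G ^+ 2 <= (2 + K1) * (K2 * e).
  apply: (@le_trans _ _ (kk * G ^+ 2 * (D + Ep))).
    by rewrite ler_peMr// mulr_ge0 ?sqr_ge0// ltW.
  rewrite mulrDr; move: B1 B2; set x := kk * _ * D; set y := kk * _ * Ep; lra.
have np : bwnorm p <= d.+1%:R * (2 ^+ d * kk).
  apply: bwnorm_coef_le => i; rewrite pE coefZ cabsM mulrC ler_wpM2r ?cabs_ge0//.
  by rewrite [X in _ <= 2 ^+ X]ds; exact: prod_ulin_coef_le (w0 :: s) i.
have /andP[dq0 _] := dBW_range p0 q0.
have B5 : e <= dBW p q * (d.+1%:R * (2 ^+ d * kk)).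
  by apply: (le_trans lE); rewrite ler_wpM2l.
rewrite -(ler_pM2l kk0); apply: (le_trans B4).
have -> : kk * (K * dBW p q) = (2 + K1) * (K2 * (dBW p q * (d.+1%:R * (2 ^+ d * kk)))).
  by rewrite /K; ring.
by rewrite ler_wpM2l ?ler_wpM2l// ?(ltW K20)//; lra.
Qed.
End LowerBound.

(** * Wasserstein geodesics of root measures *)

Section Curves.
Variable R : realType.
Variable d : nat.
Implicit Types (g : R -> bform R d * cp1 R).

Lemma speedV_ge0 g t : 0 <= speedV g t.
Proof.
rewrite /speedV; set F := (X in lim (X @ _)).
have [cF|ncF] := pselect (cvg (F @ 0^')).
  apply: limr_ge => //; near=> h.
  by rewrite /F divr_ge0// /dprod sqrtr_ge0.
(* Where the limit does not exist, [lim] is the default point of [R], which is zero. *)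
by rewrite (dvgP ncF).
Unshelve. all: by end_near.
Qed.

(** Absolute continuity of the integral of [m]. Uniformity in [s] is needed in order to cover
    [[0, 1]] by finitely many steps of one length. *)
Lemma abs_cont_lift_uniform g : abs_cont g -> forall e : R, 0 < e ->
  exists2 eta : R, 0 < eta & forall s t, 0 <= s -> s <= t -> t <= 1 -> t - s < eta ->
    fs_dist (g s).2 (g t).2 < e.
Proof.
move=> [m [mi hm]] e e0.
pose fab := m \_ `[0, 1].
have int_fab : (@lebesgue_measure R).-integrable setT (EFin \o fab).
  by rewrite -restrict_EFin; apply/integrable_restrict => //=; rewrite setTI.
have [eta [eta0 hA]] := integral_normr_continuous int_fab e0.
exists eta => // s t s0 st t1 ste.
have sub : `[s, t] `<=` `[0%R, 1%R].
  by move=> x /=; rewrite !in_itv/= => /andP[h1 h2]; rewrite (le_trans s0 h1) (le_trans h2 t1).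
have mi' : (@lebesgue_measure R).-integrable `[s, t] (EFin \o m) by exact: integrableS mi.
have := hm s t s0 st t1.
rewrite -[X in (_ <= X)%E]fineK ?integrable_fin_num// lee_fin -/(Rintegral _ _ m) => h.
have h1 : fs_dist (g s).2 (g t).2 <= dprod (g s) (g t).
  rewrite /dprod -[leLHS](ger0_norm (fs_ge0 _ _)) -sqrtr_sqr ler_wsqrtr//.
  by rewrite lerDr sqr_ge0.
apply: (le_lt_trans h1); apply: (le_lt_trans h).
apply: (le_lt_trans (ler_norm _)).
apply: (le_lt_trans (le_normr_Rintegral _ mi')) => //.
rewrite -(setIidl sub) Rintegral_mkcondr/=.
under eq_Rintegral do rewrite restrict_normr.
apply: hA => //.
by rewrite /= lebesgue_measure_itv/=; case: ifP => _; rewrite lte_fin.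
Qed.
End Curves.

Section Integral.
Import HBNNSimple.
Local Open Scope ereal_scope.

(* The integral of a nonnegative function is a supremum over the simple functions
   below it, so no measurability is needed. *)
Lemma integral_le_scale (dd : measure_display) (T : measurableType dd) (R : realType)
  (mu : {measure set T -> \bar R}) (D : set T) (u v : T -> R) (K : R) : (0 <= K)%R ->
  (forall t, D t -> 0 <= u t)%R -> (forall t, D t -> 0 <= v t)%R ->
  (forall t, D t -> v t <= K * u t)%R ->
  \int[mu]_(t in D) (v t)%:E <= K%:E * \int[mu]_(t in D) (u t)%:E.
Proof.
move=> K0 u0 v0 vu.
have iu0 : 0 <= \int[mu]_(t in D) (u t)%:E.
  by apply: integral_ge0 => t Dt; rewrite lee_fin u0.
have [K_0|K_n0] := eqVneq K 0%R.
  rewrite integral0_eq ?K_0 ?mul0e// => t Dt.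
  by congr EFin; apply/eqP; rewrite eq_le v0// andbT (le_trans (vu _ Dt))// K_0 mul0r.
have Kp : (0 < K)%R by rewrite lt_neqAle eq_sym K_n0.
rewrite ge0_integralE; last by move=> t Dt; rewrite lee_fin v0.
apply: ge_ereal_sup => _ [h hv <-].
have Ki : (0 <= K^-1)%R by rewrite invr_ge0.
have e : sintegral mu h = K%:E * sintegral mu (cst K^-1 \* h)%R.
  by rewrite sintegralrM muleA -EFinM mulfV// mul1e.
rewrite e lee_pmul2l ?lte_fin// ge0_integralE; last by move=> t Dt; rewrite lee_fin u0.
apply: ereal_sup_ubound; exists (scale_nnsfun h Ki) => // t /=.
have := hv t; rewrite /patch; case: ifPn => tD; rewrite !lee_fin => ht.
  rewrite mulrC ler_pdivrMr// mulrC (le_trans ht)// vu//.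
  exact: set_mem.
by rewrite mulr_ge0_le0.
Qed.
End Integral.

(** * Optimal plans along a geodesic of root measures *)

Section Geodesic.
Variables (R : realType) (d : nat).
Implicit Types (s t u : R) (x y z : cp1 R) (f g h : cp1 R -> cp1 R -> R).
Hypothesis d_gt0 : (0 < d)%N.
Variables (p : R -> bform R d) (rs : R -> seq (cp1 R)).
Hypothesis p_rs : forall t, 0 <= t <= 1 -> root_list (p t) (rs t).
Hypothesis geod : forall s t, 0 <= s <= 1 -> 0 <= t <= 1 ->
  W2 (mu (p s)) (mu (p t)) = `|t - s| * W2 (mu (p 0)) (mu (p 1)).

Local Notation S t := (undup (rs t)).
Local Notation m t := (mu (p t)).
Local Notation W := (W2 (mu (p 0)) (mu (p 1))).
Local Notation fs := (@fs_dist R).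

Let in01_0 : 0 <= (0 : R) <= 1. Proof. by rewrite lexx ler01. Qed.
Let in01_1 : 0 <= (1 : R) <= 1. Proof. by rewrite lexx ler01. Qed.
Let dR : 0 < (d%:R : R). Proof. by rewrite ltr0n. Qed.

Lemma mu_count t z : 0 <= t <= 1 -> m t z = (count_mem z (rs t))%:R / d%:R.
Proof. by move=> t01; rewrite /mu (mult_count _ (p_rs t01)). Qed.

Lemma mu_ge0 t z : 0 <= m t z.
Proof. by rewrite /mu divr_ge0. Qed.

Lemma mu_notin t z : 0 <= t <= 1 -> z \notin S t -> m t z = 0.
Proof.
by move=> t01; rewrite mem_undup mu_count// => /count_memPn ->; rewrite mul0r.
Qed.

Lemma mu_ge t z : 0 <= t <= 1 -> z \in S t -> d%:R^-1 <= m t z.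
Proof.
move=> t01; rewrite mem_undup mu_count// -has_pred1 has_count => c0.
by rewrite ler_peMl ?invr_ge0// ler1n.
Qed.

Lemma mu_gt0 t z : 0 <= t <= 1 -> z \in S t -> 0 < m t z.
Proof. by move=> t01 /(mu_ge t01); apply: lt_le_trans; rewrite invr_gt0. Qed.

Lemma mu_sum t : 0 <= t <= 1 -> \sum_(z <- S t) m t z = 1.
Proof.
move=> t01; under eq_bigr => z _ do rewrite mu_count//.
rewrite -mulr_suml.
have -> : \sum_(z <- S t) (count_mem z (rs t))%:R = \sum_(z <- rs t) (1 : R).
  by rewrite -[RHS]big_undup_iterop_count.
rewrite big_const_seq count_predT (p_rs t01).1 iter_addr_0 mulfV//.
by rewrite gt_eqF.
Qed.

Definition geo_opt s t f :=
  coupling (S s) (m s) (S t) (m t) f /\ cost fs (S s) (S t) f = (`|t - s| * W) ^+ 2.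

Lemma geo_opt_exists s t : 0 <= s <= 1 -> 0 <= t <= 1 -> exists f, geo_opt s t f.
Proof.
move=> s01 t01.
have [_ [f fc fW]] := W2_optimal (undup_uniq (rs s)) (undup_uniq (rs t))
  (fun z => @mu_notin s z s01) (fun z => @mu_notin t z t01) (@mu_ge0 s) (@mu_ge0 t)
  (mu_sum s01) (mu_sum t01).
by exists f; split=> //; rewrite fW geod.
Qed.

Lemma geo_lower s t h : 0 <= s <= 1 -> 0 <= t <= 1 ->
  coupling (S s) (m s) (S t) (m t) h -> (`|t - s| * W) ^+ 2 <= cost fs (S s) (S t) h.
Proof.
move=> s01 t01 hc.
have [hl _] := W2_optimal (undup_uniq (rs s)) (undup_uniq (rs t))
  (fun z => @mu_notin s z s01) (fun z => @mu_notin t z t01) (@mu_ge0 s) (@mu_ge0 t)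
  (mu_sum s01) (mu_sum t01).
by have := hl h hc; rewrite geod.
Qed.

Section Glue.
Variables (s t u : R) (f g : cp1 R -> cp1 R -> R).
Hypotheses (s0 : 0 <= s) (st : s < t) (tu : t < u) (u1 : u <= 1).
Hypotheses (fo : geo_opt s t f) (go : geo_opt t u g).

Let t01 : 0 <= t <= 1.
Proof. by rewrite (le_trans s0 (ltW st)) (le_trans (ltW tu) u1). Qed.
Let s01 : 0 <= s <= 1.
Proof. by have /andP[_ t1] := t01; rewrite s0 (le_trans (ltW st) t1). Qed.
Let u01 : 0 <= u <= 1.
Proof. by have /andP[t0 _] := t01; rewrite u1 (le_trans t0 (ltW tu)). Qed.
Let a0 : 0 < t - s. Proof. by rewrite subr_gt0. Qed.
Let b0 : 0 < u - t. Proof. by rewrite subr_gt0. Qed.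
Let fW : cost fs (S s) (S t) f = ((t - s) * W) ^+ 2.
Proof. by rewrite fo.2 ger0_norm// ltW. Qed.
Let gW : cost fs (S t) (S u) g = ((u - t) * W) ^+ 2.
Proof. by rewrite go.2 ger0_norm// ltW. Qed.
Let hW h : coupling (S s) (m s) (S u) (m u) h ->
  ((t - s + (u - t)) * W) ^+ 2 <= cost fs (S s) (S u) h.
Proof.
move=> hc; have := geo_lower s01 u01 hc.
by rewrite ger0_norm ?subr_ge0 ?(ltW (lt_trans st tu))//; have -> : t - s + (u - t) = u - s by ring.
Qed.
Let m1 y : y \in S t -> 0 < m t y. Proof. exact: mu_gt0. Qed.

(** This closure under composition allows plans over short intervals to be chained. *)
Lemma geo_glue : geo_opt s u (gluing (S t) (m t) f g).
Proof.
split; first exact: glue_coupling fo.1 go.1 m1.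
rewrite (glue_cost fo.1 go.1 m1 a0 b0 fW gW hW (@fs_ge0 R) (@fs_triangle R)).
rewrite ger0_norm ?subr_ge0 ?(ltW (lt_trans st tu))//.
by have -> : t - s + (u - t) = u - s by ring.
Qed.

Lemma geo_glue_optimal : optimal fs (S s) (m s) (S u) (m u) (gluing (S t) (m t) f g).
Proof.
exact: (glue_optimal fo.1 go.1 m1 a0 b0 fW gW hW (@fs_ge0 R) (@fs_triangle R)).
Qed.

Lemma geo_between x y z : 0 < f x y -> 0 < g y z ->
  fs x z = fs x y + fs y z /\ (u - t) * fs x y = (t - s) * fs y z.
Proof.
exact: (glue_between fo.1 go.1 m1 a0 b0 fW gW hW (@fs_ge0 R) (@fs_triangle R)).
Qed.

Lemma geo_glue_gt0 x y z : 0 < f x y -> 0 < g y z -> 0 < gluing (S t) (m t) f g x z.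
Proof. exact: (glue_gt0 fo.1 go.1 m1). Qed.

Lemma geo_glue_supp x z : 0 < gluing (S t) (m t) f g x z -> exists2 y, 0 < f x y & 0 < g y z.
Proof. exact: (glue_supp fo.1 go.1). Qed.
End Glue.

Lemma geo_gap t f g x y z x' y' z' : 0 < t < 1 -> geo_opt 0 t f -> geo_opt t 1 g ->
  0 < f x y -> 0 < g y z -> 0 < f x' y' -> 0 < g y' z' ->
  (1 - t) ^+ 2 * fs x x' ^+ 2 + t ^+ 2 * fs z z' ^+ 2 <= fs y y' ^+ 2.
Proof.
move=> t01 fo go fxy gyz fxy' gyz'; have /andP[t0 t1] := t01.
have [e1 e2] := geo_between (lexx 0) t0 t1 (lexx 1) fo go fxy gyz.
have [e1' e2'] := geo_between (lexx 0) t0 t1 (lexx 1) fo go fxy' gyz'.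
rewrite subr0 in e2 e2'.
have ho := geo_glue_optimal (lexx 0) t0 t1 (lexx 1) fo go.
have h1 := geo_glue_gt0 (lexx 0) t0 t1 (lexx 1) fo go fxy gyz.
have h2 := geo_glue_gt0 (lexx 0) t0 t1 (lexx 1) fo go fxy' gyz'.
have cm := optimal_monotone (undup_uniq _) (undup_uniq _) ho h1 h2.
by apply: fs_geodesic_gap => //; rewrite ?e1 ?e1'; lra.
Qed.

Lemma geo_exl s t f y : 0 <= t <= 1 -> geo_opt s t f -> y \in S t -> exists x, 0 < f x y.
Proof. by move=> t01 [fc _] yS; apply: (coupling_exl fc) => //; exact: mu_gt0. Qed.

Lemma geo_exr s t f x : 0 <= s <= 1 -> geo_opt s t f -> x \in S s -> exists y, 0 < f x y.
Proof. by move=> s01 [fc _] xS; apply: (coupling_exr fc) => //; exact: mu_gt0. Qed.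

Hypotheses (simple0 : forall z, (count_mem z (rs 0) <= 1)%N)
  (simple1 : forall z, (count_mem z (rs 1) <= 1)%N).

Let mu0_le z : m 0 z <= d%:R^-1.
Proof. by rewrite mu_count// ler_piMl ?invr_ge0// lern1. Qed.
Let mu1_le z : m 1 z <= d%:R^-1.
Proof. by rewrite mu_count// ler_piMl ?invr_ge0// lern1. Qed.

Section Interior.
Variables (t : R) (f g : cp1 R -> cp1 R -> R).
Hypotheses (t01 : 0 < t < 1) (fo : geo_opt 0 t f) (go : geo_opt t 1 g).
Let t01' : 0 <= t <= 1. Proof. by have /andP[/ltW -> /ltW ->] := t01. Qed.

Let sq_mul_eq0 (c a b e : R) : 0 < c -> 0 <= e -> c ^+ 2 * a ^+ 2 + e <= b ^+ 2 -> b = 0 -> a = 0.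
Proof.
move=> c0 e0 h b0; rewrite b0 expr0n/= in h.
apply/eqP; rewrite -sqrf_eq0 -(mulrI_eq0 _ (mulfI (lt0r_neq0 (exprn_gt0 2 c0)))).
by rewrite eq_le mulr_ge0 ?sqr_ge0// andbT; lra.
Qed.

(** No branching at an interior time: both pairs are continued by the same [z], and the gap
    inequality at [y = y'] leaves [(1 - t)^2 d(x, x')^2 <= 0]. *)
Lemma geo_uniql x x' y : 0 < f x y -> 0 < f x' y -> x = x'.
Proof.
move=> h h'; have [_ yS] := coupling_supp fo.1 h.
have [z gz] := geo_exr t01' go yS; have /andP[t0 t1] := t01.
have := geo_gap t01 fo go h gz h' gz => /sq_mul_eq0 H.
by apply: fs_eq0; apply: H; rewrite ?subr_gt0// ?fs_refl// mulr_ge0 ?sqr_ge0.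
Qed.

Lemma geo_uniqr y z z' : 0 < g y z -> 0 < g y z' -> z = z'.
Proof.
move=> h h'; have [yS _] := coupling_supp go.1 h.
have [x fx] := geo_exl t01' fo yS; have /andP[t0 t1] := t01.
have := geo_gap t01 fo go fx h fx h'; rewrite addrC => /sq_mul_eq0 H.
by apply: fs_eq0; apply: H; rewrite ?fs_refl// mulr_ge0 ?sqr_ge0.
Qed.

Lemma geo_massl x y : 0 < f x y -> f x y = m t y.
Proof.
move=> h; have [xS yS] := coupling_supp fo.1 h; case: fo.1 => f0 _ _ /(_ y yS) <-.
rewrite (bigD1_seq x) ?undup_uniq//= big1 ?addr0// => x' xx'.
apply/eqP; rewrite eq_le f0 andbT leNgt; apply/negP => h'.
by rewrite (geo_uniql h h') eqxx in xx'.
Qed.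

Lemma geo_massr y z : 0 < g y z -> g y z = m t y.
Proof.
move=> h; have [yS zS] := coupling_supp go.1 h; case: go.1 => g0 _ /(_ y yS) <- _.
rewrite (bigD1_seq z) ?undup_uniq//= big1 ?addr0// => z' zz'.
apply/eqP; rewrite eq_le g0 andbT leNgt; apply/negP => h'.
by rewrite (geo_uniqr h h') eqxx in zz'.
Qed.

(** All the mass of [y] comes from one root at time 0, which holds only [1 / d]. *)
Lemma geo_simple y : (count_mem y (rs t) <= 1)%N.
Proof.
have [yS|] := boolP (y \in S t); last by rewrite mem_undup => /count_memPn ->.
have [x fx] := geo_exl t01' fo yS.
have [xS _] := coupling_supp fo.1 fx.
have : m t y <= d%:R^-1.
  apply: le_trans (mu0_le x); rewrite -(geo_massl fx).
  case: fo.1 => f0 _ /(_ x xS) <- _.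
  by rewrite (bigD1_seq y) ?undup_uniq//= lerDl sumr_ge0.
by rewrite mu_count// ler_pdivrMr// mulVf ?gt_eqF// lern1.
Qed.

Let two_le (F : cp1 R -> R) (s : seq (cp1 R)) y y' : (forall z, 0 <= F z) -> uniq s ->
  y \in s -> y' \in s -> y != y' -> F y + F y' <= \sum_(z <- s) F z.
Proof.
move=> F0 us ys ys' yy'; rewrite (big_rem y)//= lerD2l (big_rem y')/=.
  by rewrite lerDl sumr_ge0.
by rewrite mem_rem_uniq// inE eq_sym yy'.
Qed.

(** Two distinct roots fed by the same [x] would draw from it a mass of at least [2 / d], while [x]
    has at most [1 / d]. *)
Lemma geo_injl x x' y y' : 0 < f x y -> 0 < f x' y' -> y != y' -> x != x'.
Proof.
move=> h h' yy'; apply/eqP => xx'; rewrite -{}xx' in h'.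
have [xS yS] := coupling_supp fo.1 h; have [_ yS'] := coupling_supp fo.1 h'.
have := mu0_le x; case: fo.1 => f0 _ /(_ x xS) <- _.
have := two_le (f0 x) (undup_uniq _) yS yS' yy'.
rewrite (geo_massl h) (geo_massl h').
have := mu_ge t01' yS; have := mu_ge t01' yS'.
have : 0 < (d%:R^-1 : R) by rewrite invr_gt0.
lra.
Qed.

Lemma geo_injr z z' y y' : 0 < g y z -> 0 < g y' z' -> y != y' -> z != z'.
Proof.
move=> h h' yy'; apply/eqP => zz'; rewrite -{}zz' in h'.
have [yS zS] := coupling_supp go.1 h; have [yS' _] := coupling_supp go.1 h'.
have := mu1_le z; case: go.1 => g0 _ _ /(_ z zS) <-.
have := two_le (g0 ^~ z) (undup_uniq _) yS yS' yy'.
rewrite (geo_massr h) (geo_massr h').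
have := mu_ge t01' yS; have := mu_ge t01' yS'.
have : 0 < (d%:R^-1 : R) by rewrite invr_gt0.
lra.
Qed.
End Interior.

Lemma geo_simple_all t y : 0 <= t <= 1 -> (count_mem y (rs t) <= 1)%N.
Proof.
move=> t01; have [->|t0] := eqVneq t 0; first exact: simple0.
have [->|t1] := eqVneq t 1; first exact: simple1.
have t01' : 0 < t < 1.
  by have /andP[h1 h2] := t01; rewrite !lt_neqAle h1 h2 eq_sym t0 t1.
have [f fo] := geo_opt_exists in01_0 t01; have [g go] := geo_opt_exists t01 in01_1.
exact: geo_simple t01' fo go y.
Qed.

(** [(1 - t)^2 + t^2 >= 1 / 2]; only [1 / 4] is used, which avoids a square root. *)
Lemma sq_gap (c t a b e : R) : 0 <= c -> 0 <= t <= 1 -> c <= a -> c <= b -> 0 <= e ->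
  (1 - t) ^+ 2 * a ^+ 2 + t ^+ 2 * b ^+ 2 <= e ^+ 2 -> c / 2 <= e.
Proof.
move=> c0 /andP[t0 t1] ca cb e0 h.
rewrite -(@ler_pXn2r _ 2)// ?nnegrE ?divr_ge0//; apply: le_trans h.
have h1 : c ^+ 2 <= a ^+ 2 by rewrite ler_pXn2r// nnegrE// (le_trans c0).
have h2 : c ^+ 2 <= b ^+ 2 by rewrite ler_pXn2r// nnegrE// (le_trans c0).
have h3 : (1 - t) ^+ 2 * c ^+ 2 <= (1 - t) ^+ 2 * a ^+ 2 by rewrite ler_wpM2l ?sqr_ge0.
have h4 : t ^+ 2 * c ^+ 2 <= t ^+ 2 * b ^+ 2 by rewrite ler_wpM2l ?sqr_ge0.
apply: le_trans (lerD h3 h4); rewrite -mulrDl expr_div_n mulrC ler_wpM2r ?sqr_ge0//.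
nra.
Qed.

Lemma geo_gap_all (c : R) : 0 <= c ->
  (forall x x', x \in rs 0 -> x' \in rs 0 -> x != x' -> c <= fs x x') ->
  (forall x x', x \in rs 1 -> x' \in rs 1 -> x != x' -> c <= fs x x') ->
  forall t y y', 0 <= t <= 1 -> y \in rs t -> y' \in rs t -> y != y' -> c / 2 <= fs y y'.
Proof.
move=> c0 h0 h1 t y y' t01 yS yS' yy'.
have [t_0|tn0] := eqVneq t 0.
  by rewrite t_0 in yS yS'; apply: le_trans (h0 _ _ yS yS' yy'); lra.
have [t_1|tn1] := eqVneq t 1.
  by rewrite t_1 in yS yS'; apply: le_trans (h1 _ _ yS yS' yy'); lra.
have t01' : 0 < t < 1.
  by have /andP[h1' h2'] := t01; rewrite !lt_neqAle h1' h2' eq_sym tn0 tn1.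
have [f fo] := geo_opt_exists in01_0 t01; have [g go] := geo_opt_exists t01 in01_1.
rewrite -mem_undup in yS; rewrite -mem_undup in yS'.
have [x fx] := geo_exl t01 fo yS; have [x' fx'] := geo_exl t01 fo yS'.
have [z gz] := geo_exr t01 go yS; have [z' gz'] := geo_exr t01 go yS'.
have xx' := geo_injl t01' fo go fx fx' yy'.
have zz' := geo_injr t01' fo go gz gz' yy'.
have [xS _] := coupling_supp fo.1 fx; have [xS' _] := coupling_supp fo.1 fx'.
have [_ zS] := coupling_supp go.1 gz; have [_ zS'] := coupling_supp go.1 gz'.
rewrite !mem_undup in xS xS' zS zS'.
exact: (sq_gap c0 t01 (h0 _ _ xS xS' xx') (h1 _ _ zS zS' zz') (fs_ge0 _ _)
  (geo_gap t01' fo go fx gz fx' gz')).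
Qed.

(** A pair is extended to a triple over [[0, t]] or [[s, 1]], whichever is guaranteed to have length
    at least [1 / 2]. The triple spans at most [pi / 2 < 2], so its speed is below 4. *)
Lemma geo_move_le s t f y y' : 0 <= s -> s < t -> t <= 1 -> geo_opt s t f ->
  0 < f y y' -> fs y y' <= 4 * (t - s).
Proof.
move=> s0 st t1 fo fy; have pi2 := @pihalf_lt2 R.
have [yS yS'] := coupling_supp fo.1 fy.
have [th|th] := leP (1 / 2) t.
  have [s_0|sn0] := eqVneq s 0.
    by have := fs_le y y'; lra.
  have sp : 0 < s by rewrite lt_neqAle eq_sym sn0.
  have s01 : 0 <= s <= 1 by apply/andP; split; lra.
  have [g go] := geo_opt_exists in01_0 s01.
  have [x gx] := geo_exl s01 go yS.
  have [e1 e2] := geo_between (lexx 0) sp st t1 go fo gx fy.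
  have := fs_le x y'; have := fs_ge0 y y'; have := fs_ge0 x y; nra.
have t01 : 0 <= t <= 1 by apply/andP; split; lra.
have [g go] := geo_opt_exists t01 in01_1.
have [z gz] := geo_exr t01 go yS'.
have [e1 e2] := geo_between s0 st (ltac:(lra) : t < 1) (lexx 1) fo go fy gz.
have := fs_le y z; have := fs_ge0 y y'; have := fs_ge0 y' z; nra.
Qed.

(** * Following a lift through chained plans *)

Section Lift.
Variables (z : R -> cp1 R) (c eta : R).
Hypothesis z_root : forall t, 0 <= t <= 1 -> z t \in rs t.
Hypothesis gap : forall t y y', 0 <= t <= 1 -> y \in rs t -> y' \in rs t -> y != y' -> c <= fs y y'.
Hypothesis eta_gt0 : 0 < eta.
Hypothesis z_cont : forall s t, 0 <= s -> s < t -> t <= 1 -> t - s < eta ->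
  fs (z s) (z t) + 4 * (t - s) < c.

(** From [y] to [z t] the plan moves by at most [4 (t - s)]; adding the motion of the lift, [y] and
    [z s] are roots at the same time closer than the gap [c]. *)
Lemma near_left s t f y : 0 <= s -> s < t -> t <= 1 -> t - s < eta -> geo_opt s t f ->
  0 < f y (z t) -> y = z s.
Proof.
move=> s0 st t1 ste fo fy; apply/eqP; apply/negPn/negP => yz.
have s01 : 0 <= s <= 1 by apply/andP; split; lra.
have [yS _] := coupling_supp fo.1 fy; rewrite mem_undup in yS.
have := gap s01 yS (z_root s01) yz; have := z_cont s0 st t1 ste.
have := geo_move_le s0 st t1 fo fy; have := fs_triangle y (z t) (z s).
by rewrite (fs_sym (z t)); lra.
Qed.

Lemma near_right s t f y : 0 <= s -> s < t -> t <= 1 -> t - s < eta -> geo_opt s t f ->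
  0 < f (z s) y -> y = z t.
Proof.
move=> s0 st t1 ste fo fy; apply/eqP; apply/negPn/negP => yz.
have t01 : 0 <= t <= 1 by apply/andP; split; lra.
have [_ yS] := coupling_supp fo.1 fy; rewrite mem_undup in yS.
have := gap t01 yS (z_root t01) yz; have := z_cont s0 st t1 ste.
have := geo_move_le s0 st t1 fo fy; have := fs_triangle y (z s) (z t).
by rewrite (fs_sym y (z s)); lra.
Qed.

(** Induction on the number of steps of length [eta / 2]. The statement provides one plan leading
    back to [z 0], the chained one; this suffices, as the gap inequality accepts any optimal
    plan. *)
Lemma lift_left_step n t : 0 < t -> t <= 1 -> t <= n.+1%:R * (eta / 2) ->
  exists2 f, geo_opt 0 t f & forall x, 0 < f x (z t) -> x = z 0.
Proof.
have h0 : 0 < eta / 2 by rewrite divr_gt0.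
have h1 : eta / 2 < eta by rewrite ltr_pdivrMr// ltr_pMr// ltr1n.
elim: n t => [|n IH] t t0 t1 tn.
  have t01 : 0 <= t <= 1 by rewrite ltW.
  have [f fo] := geo_opt_exists in01_0 t01; exists f => // x.
  by apply: near_left fo; rewrite ?subr0// (le_lt_trans tn)// mul1r.
have [th|th] := leP t (eta / 2).
  have t01 : 0 <= t <= 1 by rewrite ltW.
  have [f fo] := geo_opt_exists in01_0 t01; exists f => // x.
  by apply: near_left fo; rewrite ?subr0// (le_lt_trans th).
have tn' : t - eta / 2 <= n.+1%:R * (eta / 2).
  by move: tn; rewrite -[n.+2]addn1 natrD mulrDl mul1r lerBlDr.
have [||f fo fz] := IH (t - eta / 2) _ _ tn'; [by rewrite subr_gt0|lra|].
set s := t - eta / 2 in fo fz tn'.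
have s0 : 0 < s by rewrite subr_gt0.
have st : s < t by rewrite /s ltrBlDr ltrDl.
have s01 : 0 <= s <= 1 by apply/andP; split; lra.
have t01 : 0 <= t <= 1 by apply/andP; split; lra.
have [g go] := geo_opt_exists s01 t01.
exists (gluing (S s) (m s) f g); first exact: geo_glue fo go.
move=> x /(geo_glue_supp fo go)[y fy gy].
have yz : y = z s by apply: (near_left (ltW s0) st t1 _ go gy); rewrite /s opprB addrC subrK.
by apply: fz; rewrite -yz.
Qed.

Lemma lift_right_step n t : 0 <= t -> t < 1 -> 1 - t <= n.+1%:R * (eta / 2) ->
  exists2 g, geo_opt t 1 g & forall x, 0 < g (z t) x -> x = z 1.
Proof.
have h0 : 0 < eta / 2 by rewrite divr_gt0.
have h1 : eta / 2 < eta by rewrite ltr_pdivrMr// ltr_pMr// ltr1n.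
elim: n t => [|n IH] t t0 t1 tn.
  have t01 : 0 <= t <= 1 by rewrite t0 ltW.
  have [f fo] := geo_opt_exists t01 in01_1; exists f => // x.
  by apply: near_right fo => //; rewrite (le_lt_trans tn)// mul1r.
have [th|th] := leP (1 - t) (eta / 2).
  have t01 : 0 <= t <= 1 by rewrite t0 ltW.
  have [f fo] := geo_opt_exists t01 in01_1; exists f => // x.
  by apply: near_right fo => //; rewrite (le_lt_trans th).
have tn' : 1 - (t + eta / 2) <= n.+1%:R * (eta / 2).
  by rewrite -[n.+2]addn1 natrD mulrDl mul1r in tn; lra.
have [||g go gz] := IH (t + eta / 2) _ _ tn'; [lra|lra|].
set s := t + eta / 2 in go gz tn'.
have s1 : s < 1 by rewrite /s; lra.
have st : t < s by rewrite /s ltrDl.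
have s01 : 0 <= s <= 1 by apply/andP; split; lra.
have t01 : 0 <= t <= 1 by apply/andP; split; lra.
have [f fo] := geo_opt_exists t01 s01.
exists (gluing (S s) (m s) f g); first exact: geo_glue fo go.
move=> x /(geo_glue_supp fo go)[y fy gy].
have yz : y = z s by apply: (near_right t0 st (ltW s1) _ fo fy); rewrite /s addrAC subrr add0r.
by apply: gz; rewrite -yz.
Qed.

(** As in [geo_gap_all], but one of the two triples is that of the lift. So only gaps around [z 0]
    and [z 1] enter, and these are what [nu_norm] at the ends controls. *)
Lemma lift_gap (e : R) t w : 0 <= e ->
  (forall x, x \in rs 0 -> x != z 0 -> e <= fs (z 0) x) ->
  (forall x, x \in rs 1 -> x != z 1 -> e <= fs (z 1) x) ->
  0 <= t <= 1 -> w \in rs t -> w != z t -> e / 2 <= fs (z t) w.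
Proof.
move=> e0 h0 h1 t01 wS wz.
have [t_0|tn0] := eqVneq t 0.
  by rewrite t_0 in wS wz *; apply: le_trans (h0 _ wS wz); lra.
have [t_1|tn1] := eqVneq t 1.
  by rewrite t_1 in wS wz *; apply: le_trans (h1 _ wS wz); lra.
have t01' : 0 < t < 1.
  by have /andP[h1' h2'] := t01; rewrite !lt_neqAle h1' h2' eq_sym tn0 tn1.
have /andP[t0 t1] := t01'.
have eh : 0 < eta / 2 by rewrite divr_gt0.
have [n nh] : exists n, 1 <= n.+1%:R * (eta / 2).
  exists (Num.bound (eta / 2)^-1).
  rewrite -ler_pdivrMr// div1r; apply: ltW.
  apply: (lt_trans (archi_boundP _)); first by rewrite invr_ge0 ltW.
  by rewrite ltr_nat.
have [f fo fz] := @lift_left_step n t t0 (ltW t1) (le_trans (ltW t1) nh).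
have [g go gz] : exists2 g, geo_opt t 1 g & forall x, 0 < g (z t) x -> x = z 1.
  by apply: (@lift_right_step n) => //; rewrite ?(ltW t0)//; lra.
have zS := z_root t01; rewrite -mem_undup in zS; rewrite -mem_undup in wS.
have [x fx] := geo_exl t01 fo zS; have [x' fx'] := geo_exl t01 fo wS.
have [y gy] := geo_exr t01 go zS; have [y' gy'] := geo_exr t01 go wS.
have xx' := geo_injl t01' fo go fx' fx wz; have yy' := geo_injr t01' fo go gy' gy wz.
have [xS' _] := coupling_supp fo.1 fx'; have [_ yS'] := coupling_supp go.1 gy'.
rewrite !mem_undup in xS' yS'.
have G := geo_gap t01' fo go fx gy fx' gy'.
rewrite (fz _ fx) in xx' G; rewrite (gz _ gy) in yy' G.
exact: (sq_gap e0 t01 (h0 _ xS' xx') (h1 _ yS' yy') (fs_ge0 _ _) G).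
Qed.
End Lift.
End Geodesic.

(** * Root gaps against distances to the discriminant *)

Section DistSet.
Variables (R : realType) (d : nat).
Implicit Types (p q : bform R d) (A : set (bform R d)) (rs s : seq (cp1 R)).

Lemma dist_set_le p A q : p != (fun _ => 0) -> (forall q, A q -> q != (fun _ => 0)) ->
  A q -> dist_set p A <= dBW p q.
Proof.
move=> p0 A0 Aq; apply: ge_inf; last by exists q.
by exists 0 => _ [q' [Aq' ->]]; have /andP[] := dBW_range p0 (A0 _ Aq').
Qed.

(** Nonemptiness matters: the infimum of the empty set is 0. *)
Lemma dist_set_ge p A c : A !=set0 -> (forall q, A q -> c <= dBW p q) -> c <= dist_set p A.
Proof.
by move=> [q Aq] h; apply: lb_le_inf => [|_ [q' [Aq' ->]]]; [exists (dBW p q), q|exact: h].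
Qed.

Lemma seq_argmin (I : eqType) (F : I -> R) (s : seq I) x : x \in s ->
  exists2 y, y \in s & forall w, w \in s -> F y <= F w.
Proof.
elim: s x => // a s IH x _.
have [->|] := eqVneq s [::].
  by exists a; rewrite ?mem_seq1// => w; rewrite mem_seq1 => /eqP ->.
case: s IH => // b s IH _; have [y ys hy] := IH b (mem_head _ _).
have [ay|/ltW ya] := leP (F a) (F y).
  exists a; first exact: mem_head.
  by move=> w; rewrite in_cons => /orP[/eqP ->//|/hy]; exact: le_trans.
exists y; first by rewrite in_cons ys orbT.
by move=> w; rewrite in_cons => /orP[/eqP ->//|/hy].
Qed.

Lemma exists_gap s : exists2 c : R, 0 < c &
  forall x x', x \in s -> x' \in s -> x != x' -> c <= fs_dist x x'.
Proof.
pose P := [seq e <- [seq (x, x') | x <- s, x' <- s] | e.1 != e.2].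
have inP x x' : x \in s -> x' \in s -> x != x' -> (x, x') \in P.
  by move=> xs xs' xx'; rewrite mem_filter/= xx'/=; apply/allpairsP; exists (x, x').
have [P0|] := eqVneq P [::].
  by exists 1 => // x x' xs xs' xx'; have := inP _ _ xs xs' xx'; rewrite P0.
case E : P => [//|e P'] _.
have [|[y y'] yP hy] := @seq_argmin _ (fun e => fs_dist e.1 e.2) P e.
  by rewrite E mem_head.
exists (fs_dist y y'); last by move=> x x' xs xs' xx'; exact: (hy _ (inP _ _ xs xs' xx')).
rewrite lt_neqAle fs_ge0 andbT eq_sym; apply/eqP => /fs_eq0 yy'.
by move: yP; rewrite mem_filter/= yy' eqxx.
Qed.

Lemma half_fs_le_sin (z w : cp1 R) : fs_dist z w / 2 <= sin (fs_dist z w).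
Proof.
by have := fs_le_sin z w; have := fs_sin_ge0 z w; have := @pihalf_lt2 R; nra.
Qed.

Lemma prod_ge (I : eqType) (F : I -> R) (s : seq I) a : 0 <= a ->
  (forall w, w \in s -> a <= F w) -> a ^+ size s <= \prod_(w <- s) F w.
Proof.
move=> a0; elim: s => [|x s IH] h; first by rewrite big_nil expr0.
rewrite big_cons exprS ler_pM ?exprn_ge0//; first by apply: h; exact: mem_head.
by apply: IH => w ws; apply: h; rewrite in_cons ws orbT.
Qed.

Lemma count_le1_uniq (s : seq (cp1 R)) : (forall x, (count_mem x s <= 1)%N) -> uniq s.
Proof.
move=> h; apply: count_mem_uniq => x; have := h x.
have [xs|/count_memPn ->//] := boolP (x \in s).
by move: xs; rewrite -has_pred1 has_count; case: (count_mem x s) => [|[|]].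
Qed.

Section Bounds.
Variables (p : bform R d) (rs : seq (cp1 R)) (KA KB : R).
Hypotheses (d_gt1 : (1 < d)%N) (p_rs : root_list p rs) (urs : uniq rs).
Hypotheses (KA0 : 0 < KA) (KB0 : 0 < KB).
Hypothesis hA : forall p rs z w, root_list p rs -> z \in rs -> w \in rs -> z != w ->
  exists2 q, @Delta_at R d z q & dBW p q <= KA * fs_dist z w.
Hypothesis hB : forall p rs z w0 q, root_list p rs -> w0 \in rs -> @Delta_at R d z q ->
  (\prod_(w <- rem w0 rs) sin (fs_dist z w)) ^+ 2 <= KB * dBW p q.

Let p0 : p != (fun _ => 0). Proof. exact: root_list_nz p_rs. Qed.

Lemma exists_other z : z \in rs -> exists2 w, w \in rs & z != w.
Proof.
move=> zrs.
have : (0 < size (rem z rs))%N by rewrite size_rem// p_rs.1 -subn1 subn_gt0.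
case E : (rem z rs) => [//|w s'] _.
have : w \in rem z rs by rewrite E mem_head.
by rewrite mem_rem_uniq// inE => /andP[wz ws]; exists w => //; rewrite eq_sym.
Qed.

Lemma Delta_at_nonempty z : z \in rs -> @Delta_at R d z !=set0.
Proof.
by move=> zrs; have [w wrs zw] := exists_other zrs; have [q hq _] := hA p_rs zrs wrs zw; exists q.
Qed.

Lemma some_root : exists z, z \in rs.
Proof.
have : (0 < size rs)%N by rewrite p_rs.1 ltnW.
by case: (rs) => [//|z s] _; exists z; exact: mem_head.
Qed.

Lemma Delta_at_sub z : @Delta_at R d z `<=` @Delta R d.
Proof. by move=> q [q0 hq]; split=> //; exists z. Qed.

Lemma Delta_nonempty : @Delta R d !=set0.
Proof.
have [z zrs] := some_root; have [q hq] := Delta_at_nonempty zrs.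
by exists q; exact: Delta_at_sub hq.
Qed.

Lemma distDelta_ge0 : 0 <= distDelta p.
Proof.
apply: dist_set_ge => [|q [q0 _]]; first exact: Delta_nonempty.
by have /andP[] := dBW_range p0 q0.
Qed.

Lemma distDelta_le z w : z \in rs -> w \in rs -> z != w -> distDelta p / KA <= fs_dist z w.
Proof.
move=> zrs wrs zw; have [q hq hle] := hA p_rs zrs wrs zw.
rewrite ler_pdivrMr// mulrC; apply: le_trans hle.
by apply: dist_set_le => //; [by move=> q' []|exact: Delta_at_sub hq].
Qed.

Lemma dist_at_le z w : z \in rs -> w \in rs -> z != w ->
  dist_set p (@Delta_at R d z) / KA <= fs_dist z w.
Proof.
move=> zrs wrs zw; have [q hq hle] := hA p_rs zrs wrs zw.
rewrite ler_pdivrMr// mulrC; apply: le_trans hle.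
by apply: dist_set_le => // q' [].
Qed.

Lemma size_rem_rs z : z \in rs -> size (rem z rs) = d.-1.
Proof. by move=> zrs; rewrite size_rem// p_rs.1. Qed.

(** The double root [z] of [q] need not be a root of [p]. The root [w0] nearest to [z] is left out
    of the product; any other root is at distance at least [c / 2] from [z], and the sine is at
    least half of the distance, whence [c / 4]. *)
Lemma distDelta_ge c : 0 <= c ->
  (forall y y', y \in rs -> y' \in rs -> y != y' -> c <= fs_dist y y') ->
  (c / 4) ^+ (d.-1 * 2) / KB <= distDelta p.
Proof.
move=> c0 hc; apply: dist_set_ge => [|q [q0 [z hz]]]; first exact: Delta_nonempty.
have [z0 z0rs] := some_root.
have [w0 w0rs hw0] := @seq_argmin _ (fun w => fs_dist z w) rs z0 z0rs.
rewrite ler_pdivrMr// [leRHS]mulrC; apply: le_trans (hB p_rs w0rs (conj q0 hz)).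
have c4 : 0 <= c / 4 by lra.
rewrite exprM ler_pXn2r// ?nnegrE ?exprn_ge0 ?prodr_ge0//;
  last by move=> i _; exact: fs_sin_ge0.
rewrite -(size_rem_rs w0rs); apply: prod_ge => // w.
rewrite mem_rem_uniq// inE => /andP[ww0 wrs].
have := hc _ _ wrs w0rs ww0; have := fs_triangle w z w0.
have := hw0 w wrs; have := half_fs_le_sin z w; rewrite (fs_sym w z); lra.
Qed.

(** Here [z] is a root of [p] and is itself the one left out, so only gaps from [z] count and one
    factor 2 is saved. *)
Lemma dist_at_ge z c : z \in rs -> 0 <= c ->
  (forall w, w \in rs -> w != z -> c <= fs_dist z w) ->
  (c / 2) ^+ (d.-1 * 2) / KB <= dist_set p (@Delta_at R d z).
Proof.
move=> zrs c0 hc; apply: dist_set_ge => [|q hq]; first exact: Delta_at_nonempty.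
rewrite ler_pdivrMr// [leRHS]mulrC; apply: le_trans (hB p_rs zrs hq).
have c2 : 0 <= c / 2 by lra.
rewrite exprM ler_pXn2r// ?nnegrE ?exprn_ge0 ?prodr_ge0//;
  last by move=> i _; exact: fs_sin_ge0.
rewrite -(size_rem_rs zrs); apply: prod_ge => // w.
rewrite mem_rem_uniq// inE => /andP[wz wrs].
have := hc _ wrs wz; have := half_fs_le_sin z w; lra.
Qed.

Lemma dist_at_gt0 z : z \in rs -> 0 < dist_set p (@Delta_at R d z).
Proof.
move=> zrs; have [c c0 hc] := exists_gap rs.
have h : forall w, w \in rs -> w != z -> c <= fs_dist z w.
  by move=> w wrs wz; apply: hc => //; rewrite eq_sym.
apply: lt_le_trans (dist_at_ge zrs (ltW c0) h).
by rewrite divr_gt0// exprn_gt0// divr_gt0.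
Qed.
End Bounds.
End DistSet.

(** * Degree one, and the choice of the constants *)

Lemma Delta_at1 (R : realType) z : @Delta_at R 1 z = set0.
Proof.
rewrite -subset0 => q [q0]; have [rs qrs] := root_list_exists q0.
rewrite (mult_count _ qrs) => h; have := leq_trans h (count_size _ _).
by rewrite qrs.1.
Qed.

Lemma Delta1 (R : realType) : @Delta R 1 = set0.
Proof.
rewrite -subset0 => q [q0 [z h]].
by have : @Delta_at R 1 z q by []; rewrite Delta_at1.
Qed.

Lemma dist_set0 (R : realType) d (p : bform R d) : dist_set p set0 = 0.
Proof.
rewrite /dist_set (_ : [set r | _] = set0) ?inf0//.
by rewrite -subset0 => r [q []].
Qed.

Theorem mainTheorem20 (R : realType) (d : nat) (hd : (0 < d)%N) :
  exists b1 b2 b3 b4 : R, [/\ 0 < b1, 0 < b2, 0 < b3 & 0 < b4] /\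
  forall p : R -> bform R d,
    (forall t, 0 <= t <= 1 -> p t != (fun _ => 0)) ->
    ~ Delta (p 0) -> ~ Delta (p 1) ->
    (forall s t, 0 <= s <= 1 -> 0 <= t <= 1 ->
       W2 (mu (p s)) (mu (p t)) = `|t - s| * W2 (mu (p 0)) (mu (p 1))) ->
    (forall t, 0 <= t <= 1 ->
       b1 * powR (Num.min (distDelta (p 0)) (distDelta (p 1))) b2
         <= distDelta (p t) ^+ 2 /\ ~ Delta (p t)) /\
    (forall z : R -> cp1 R,
       (forall t, 0 <= t <= 1 -> inV (p t) (z t) /\ ~ inSigma' (p t) (z t)) ->
       abs_cont (fun t => (p t, z t)) ->
       (L_cond (fun t => (p t, z t))
          <= (b3 * powR (Num.max (nu_norm (p 0) (z 0)) (nu_norm (p 1) (z 1))) b4)%:E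
             * L_V (fun t => (p t, z t)))%E).
Proof.
(* In degree one the discriminant is empty, so all distances to it and all [nu_norm] are 0 by
   convention; both claims then have a zero side that makes them trivial. *)
have [d1|d1] := eqVneq d 1%N.
  subst d; exists 1, 1, 1, 1; split; first by split.
  move=> p _ _ _ _; rewrite /distDelta Delta1; split=> [t _|z _ _].
    by rewrite !dist_set0 minxx powR0 ?oner_neq0// mulr0 expr0n/=; split.
  apply: integral_le_scale.
  - by rewrite mulr_ge0// powR_ge0.
  - by move=> t _; exact: speedV_ge0.
  - by move=> t _; rewrite mulr_ge0 ?speedV_ge0// /nu_norm Delta_at1 dist_set0 invr0.
  - by move=> t _; rewrite /nu_norm !Delta_at1 !dist_set0 invr0 mul0r !mulr_ge0 ?powR_ge0 ?speedV_ge0.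
have d_gt1 : (1 < d)%N by move: hd d1; case: d => [|[]].
have [KA KA0 hA] := dBW_Delta_at_le R d.
have [KB KB0 hB] := dBW_Delta_at_ge R d.
set n := (d.-1 * 2)%N.
have n0 : (0 < n)%N by rewrite /n; move: d_gt1; lia.
(* In both constants [KA] passes from distances to gaps at the ends, the next 2 is lost from the
   ends to time [t], and the last factor and [KB] come from [distDelta_ge], respectively
   [dist_at_ge]. The power [-2] in [b1] reflects the squared distance. *)
pose b1 : R := ((KA * 2 * 4) ^+ n * KB) ^- 2.
pose b3 : R := KB * (KA * 2 * 2) ^+ n.
exists b1, (n * 2)%:R, b3, n%:R; split.
  split.
  - by rewrite invr_gt0 exprn_gt0// mulr_gt0// exprn_gt0// !mulr_gt0.
  - by rewrite ltr0n muln_gt0 n0.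
  - by rewrite mulr_gt0// exprn_gt0// !mulr_gt0.
  - by rewrite ltr0n.
move=> p pn0 D0 D1 geod.
have /choice[rs p_rs] : forall t, exists s, 0 <= t <= 1 -> root_list (p t) s.
  move=> t; have [t01|t01] := pselect (0 <= t <= 1); last by exists [::].
  by have [s hs] := root_list_exists (pn0 t t01); exists s.
have i0 : 0 <= (0 : R) <= 1 by rewrite lexx ler01.
have i1 : 0 <= (1 : R) <= 1 by rewrite lexx ler01.
have simple t : 0 <= t <= 1 -> ~ Delta (p t) -> forall z, (count_mem z (rs t) <= 1)%N.
  move=> t01 Dt z; rewrite leqNgt; apply/negP => h; apply: Dt.
  by split; [exact: pn0|exists z; rewrite (mult_count _ (p_rs t t01))].
have simple0 := simple 0 i0 D0; have simple1 := simple 1 i1 D1.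
have simple_t := geo_simple_all hd p_rs geod simple0 simple1.
have u_rs t : 0 <= t <= 1 -> uniq (rs t).
  by move=> t01; apply: count_le1_uniq => x; exact: simple_t.
split.
  move=> t t01; split; last first.
    move=> [_ [z]]; rewrite (mult_count _ (p_rs t t01)).
    by rewrite ltnNge simple_t.
  set m := Num.min _ _.
  have m0 : 0 <= m.
    have dge t' (h : 0 <= t' <= 1) := distDelta_ge0 d_gt1 (p_rs _ h) (u_rs _ h) hA.
    by rewrite le_min !dge.
  have mK0 : 0 <= m / KA by rewrite divr_ge0// ltW.
  have g0 x x' : x \in rs 0 -> x' \in rs 0 -> x != x' -> m / KA <= fs_dist x x'.
    move=> xs xs' xx'; apply: le_trans (distDelta_le (p_rs _ i0) KA0 hA xs xs' xx').
    by rewrite ler_pM2r ?invr_gt0// ge_min lexx.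
  have g1 x x' : x \in rs 1 -> x' \in rs 1 -> x != x' -> m / KA <= fs_dist x x'.
    move=> xs xs' xx'; apply: le_trans (distDelta_le (p_rs _ i1) KA0 hA xs xs' xx').
    by rewrite ler_pM2r ?invr_gt0// ge_min lexx orbT.
  have gt y y' := geo_gap_all hd p_rs geod simple0 simple1 mK0 g0 g1 (y := y) (y' := y') t01.
  have h2 : 0 <= m / KA / 2 by rewrite divr_ge0.
  have := distDelta_ge d_gt1 (p_rs _ t01) (u_rs _ t01) KB0 hA hB h2 gt.
  rewrite -/n => hD.
  have hD' : (m ^+ n / ((KA * 2 * 4) ^+ n * KB)) ^+ 2 <= distDelta (p t) ^+ 2.
    have e0 : 0 <= m ^+ n / ((KA * 2 * 4) ^+ n * KB).
      by rewrite divr_ge0 ?exprn_ge0// ltW// mulr_gt0// exprn_gt0// !mulr_gt0.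
    have le : m ^+ n / ((KA * 2 * 4) ^+ n * KB) <= distDelta (p t).
      apply: le_trans hD; rewrite invfM mulrA -exprVn -exprMn !invfM !mulrA.
      exact: lexx.
    by rewrite ler_pXn2r// nnegrE// (le_trans e0).
  apply: le_trans hD'; rewrite powR_mulrn// exprM expr_div_n /b1 mulrC.
  exact: lexx.
move=> z zV zac.
have z_root t : 0 <= t <= 1 -> z t \in rs t.
  by move=> t01; apply/(root_listP _ (p_rs t t01)); have [] := zV t t01.
(* This gap depends on the curve. It serves only to follow the lift and does not enter [b3]. *)
have [c0 c00 gap0] := exists_gap (rs 0); have [c1 c10 gap1] := exists_gap (rs 1).
pose c := Num.min c0 c1.
have c_gt0 : 0 < c by rewrite lt_min c00 c10.
have g0 x x' : x \in rs 0 -> x' \in rs 0 -> x != x' -> c <= fs_dist x x'.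
  by move=> xs xs' xx'; rewrite ge_min gap0.
have g1 x x' : x \in rs 1 -> x' \in rs 1 -> x != x' -> c <= fs_dist x x'.
  by move=> xs xs' xx'; rewrite ge_min gap1 ?orbT.
have gt := geo_gap_all hd p_rs geod simple0 simple1 (ltW c_gt0) g0 g1.
have c4 : 0 < c / 4 by rewrite divr_gt0.
have [eta eta0 hz] := abs_cont_lift_uniform zac c4.
(* The lift moves by less than [c / 4], the triples by [4 * (c / 16) = c / 4]; together they stay
   below the gap [c / 2] valid at all times. *)
pose eta' := Num.min eta (c / 16).
have eta'0 : 0 < eta' by rewrite lt_min eta0 divr_gt0.
have z_cont s t : 0 <= s -> s < t -> t <= 1 -> t - s < eta' ->
    fs_dist (z s) (z t) + 4 * (t - s) < c / 2.
  move=> s0 st t1; rewrite lt_min => /andP[h1 h2].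
  by have := hz s t s0 (ltW st) t1 h1; rewrite /=; lra.
pose N t := dist_set (p t) (@Delta_at R d (z t)).
have N_gt0 t : 0 <= t <= 1 -> 0 < N t.
  move=> t01; exact: (dist_at_gt0 d_gt1 (p_rs _ t01) (u_rs _ t01) KB0 hA hB (z_root _ t01)).
(* The gap that does enter the estimate: it measures only the surroundings of [z 0] and [z 1],
   through [dist_at_le]. *)
pose e := Num.min (N 0) (N 1) / KA.
have e_gt0 : 0 < e by rewrite divr_gt0// lt_min !N_gt0.
have e0 x : x \in rs 0 -> x != z 0 -> e <= fs_dist (z 0) x.
  rewrite eq_sym => xs xz; apply: le_trans (dist_at_le (p_rs _ i0) KA0 hA (z_root _ i0) xs xz).
  by rewrite ler_pM2r ?invr_gt0// ge_min lexx.
have e1 x : x \in rs 1 -> x != z 1 -> e <= fs_dist (z 1) x.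
  rewrite eq_sym => xs xz; apply: le_trans (dist_at_le (p_rs _ i1) KA0 hA (z_root _ i1) xs xz).
  by rewrite ler_pM2r ?invr_gt0// ge_min lexx orbT.
have nu_le t : 0 <= t <= 1 -> nu_norm (p t) (z t) <=
    b3 * powR (Num.max (nu_norm (p 0) (z 0)) (nu_norm (p 1) (z 1))) n%:R.
  move=> t01.
  have lg w := lift_gap hd p_rs geod simple0 simple1 z_root gt eta'0 z_cont (ltW e_gt0) e0 e1
    (w := w) t01.
  have e2 : 0 <= e / 2 by rewrite divr_ge0// ltW.
  have := dist_at_ge d_gt1 (p_rs _ t01) (u_rs _ t01) KB0 hA hB (z_root _ t01) e2 lg.
  rewrite -/n -/(N t) => hN.
  have mm : (Num.min (N 0) (N 1))^-1 <= Num.max (nu_norm (p 0) (z 0)) (nu_norm (p 1) (z 1)).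
    by rewrite le_max /nu_norm; case: (leP (N 0) (N 1)) => _; rewrite lexx ?orbT.
  have m0 : 0 < Num.min (N 0) (N 1) by rewrite lt_min !N_gt0.
  have mi0 : 0 <= (Num.min (N 0) (N 1))^-1 by rewrite invr_ge0 ltW.
  rewrite powR_mulrn; last exact: le_trans mm.
  apply: (@le_trans _ _ (b3 * (Num.min (N 0) (N 1))^-1 ^+ n)); last first.
    rewrite ler_wpM2l//; first by rewrite ltW// mulr_gt0// exprn_gt0// !mulr_gt0.
    by rewrite ler_pXn2r// nnegrE// (le_trans mi0).
  have hp : 0 < (e / 2 / 2) ^+ n / KB by rewrite divr_gt0// exprn_gt0// !divr_gt0.
  have -> : b3 * (Num.min (N 0) (N 1))^-1 ^+ n = ((e / 2 / 2) ^+ n / KB)^-1.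
    rewrite /b3 /e invfM invrK -exprVn -mulrA -exprMn mulrC; congr (_ ^+ n * _).
    by rewrite !invfM !invrK; ring.
  by rewrite /nu_norm lef_pV2 ?posrE// N_gt0.
apply: integral_le_scale.
- by rewrite mulr_ge0 ?powR_ge0// ltW// mulr_gt0// exprn_gt0// !mulr_gt0.
- by move=> t _; exact: speedV_ge0.
- move=> t; rewrite /= in_itv/= => t01; rewrite mulr_ge0 ?speedV_ge0//.
  by rewrite invr_ge0 ltW// N_gt0.
- move=> t; rewrite /= in_itv/= => t01; rewrite ler_wpM2r ?speedV_ge0//.
  exact: nu_le.
Qed.
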